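(* Let $K$ be a field, $n\ge 1$, and $\Lambda=K\langle x_1,\dots,x_n\rangle$ the free associative algebra. Let $\gamma,\lambda\in\Lambda$ be comonic polynomials of positive degree, and let $V_\gamma$ and $V_\lambda$ be the associated finite-dimensional left $\Lambda$-modules, with respect to the actions $\star_\gamma$ and $\star_\lambda$ respectively. Then: (1) $\lambda$ is irreducible if and only if $V_\lambda$ is a simple $\Lambda$-module. (2) If $\lambda=\pi_1\cdots\pi_m$ is a factorization of $\lambda$ into a product of irreducible polynomials, then $m$ is the length of $V_\lambda$ and the composition factors of $V_\lambda$ are isomorphic to the simple modules $V_{\pi_i}$, $i=1,\dots,m$. In particular, $m$ is an invariant of $\lambda$. (3) $V_\lambda\cong V_\gamma$ as $\Lambda$-modules if and only if $\Lambda/\Lambda\gamma\cong\Lambda/\Lambda\lambda$ as left $\Lambda$-modules, that is, if and only if $\gamma$ and $\lambda$ are similar over $\Lambda$.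
   Context: Every $\lambda\in\Lambda$ is written uniquely as $\lambda=k_\lambda+\sum_{i=1}^n x_i\lambda_{x_i}$ with $k_\lambda\in K$ (the constant term) and $\lambda_{x_i}\in\Lambda$ (the right cofactor with respect to $x_i$). For a monomial $b=x_{i_1}\cdots x_{i_l}$ with $l\ge1$, the iterated cofactor is $\lambda_b=(\cdots(\lambda_{x_{i_1}})_{x_{i_2}}\cdots)_{x_{i_l}}$. $\lambda$ is comonic if $k_\lambda=1$. The degree $|\lambda|$ is the total degree. If $k_\lambda\neq0$, $\Lambda$ is made into a left $\Lambda$-module (denoted $\Lambda_\lambda$) by letting $x_i$ act as the $K$-linear map $x_i\star_\lambda\alpha=-k_\alpha k_\lambda^{-1}\lambda_{x_i}+\alpha_{x_i}$ for $\alpha=k_\alpha+\sum_j x_j\alpha_{x_j}$. $V_\lambda$ is the $K$-subspace of $\Lambda$ spanned by all cofactors $\lambda_b$, $b$ a monomial of length $\ge1$; it is finite-dimensional and a submodule of $\Lambda_\lambda$, and is regarded as a left $\Lambda$-module via $\star_\lambda$. (If $\lambda$ is a nonzero constant, $V_\lambda=0$.) A nonzero, non-invertible element of a ring is irreducible if it is not a product of two nonzero non-invertible elements. Note that factors of a comonic polynomial have nonzero constant term. Two elements $a,b$ of a ring $A$ are similar (over $A$) if $A/Aa\cong A/Ab$ as left $A$-modules. *)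

(* Defs.v *)
From HB Require Import structures.
From mathcomp Require Import all_boot all_algebra.
From mathcomp Require Import perm generic_quotient finmap.
From mathcomp Require Import monalg boolp.

Set Implicit Arguments.
Unset Strict Implicit.
Unset Printing Implicit Defensive.

Import GRing.Theory.

Local Open Scope ring_scope.

Section Irreducible.
Variable A : nzRingType.

Definition invertible (a : A) : Prop := exists b : A, a * b = 1 /\ b * a = 1.

Definition nonzero_nonunit (a : A) : Prop := a <> 0 /\ ~ invertible a.

Definition irreducible (a : A) : Prop :=
  nonzero_nonunit a /\
  ~ exists b c : A, [/\ nonzero_nonunit b, nonzero_nonunit c & a = b * c].

End Irreducible.

(* Left modules are lmodTypes, and a submodule of M is a submodClosed M, that *)
(* is, a boolean predicate on M; since boolp is assumed, every Prop-valued    *)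
(* predicate that is closed under the module operations has this form.        *)

Section Submodule.
Variables (R : nzRingType) (M : lmodType R) (S : submodClosed M).

Record submodule : predArgType := Submodule {
  submodule_val : M;
  _ : submodule_val \in S
}.

HB.instance Definition _ := [isSub for submodule_val].
HB.instance Definition _ := [Choice of submodule by <:].
HB.instance Definition _ := [SubChoice_isSubLmodule of submodule by <:].

End Submodule.

Section QuotientModule.
Variables (R : nzRingType) (M : lmodType R) (S : submodClosed M).
Local Open Scope quotient_scope.

(* Quotient.quot takes a zmodClosed, and a submodClosed does not coerce to one. *)
Definition quotient_kernel : {pred M} := fun x => x \in S.

Fact quotient_kernel_closed : zmod_closed quotient_kernel.
Proof. exact: GRing.submod_closedB (submodClosedP S). Qed.

HB.instance Definition _ :=
  GRing.isZmodClosed.Build M quotient_kernel quotient_kernel_closed.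

Definition quotient_module := Quotient.quot quotient_kernel.
HB.instance Definition _ := GRing.Zmodule.on quotient_module.

Definition quotient_pi (x : M) : quotient_module :=
  \pi_(Quotient.quot quotient_kernel) x.

Definition quotient_scale (a : R) (x : quotient_module) : quotient_module :=
  quotient_pi (a *: repr (x : Quotient.quot quotient_kernel)).

Lemma quotient_piP x y : (quotient_pi x == quotient_pi y) = (x - y \in S).
Proof. by rewrite /quotient_pi -Quotient.idealrBE. Qed.

Lemma quotient_piD x y : quotient_pi (x + y) = quotient_pi x + quotient_pi y.
Proof. exact: (raddfD (\pi_(Quotient.quot quotient_kernel))). Qed.

Lemma quotient_piW (x : quotient_module) :
  quotient_pi (repr (x : Quotient.quot quotient_kernel)) = x.
Proof. exact: reprK. Qed.

Lemma quotient_piZ a x : quotient_pi (a *: x) = quotient_scale a (quotient_pi x).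
Proof.
apply/eqP; rewrite /quotient_scale quotient_piP -scalerBr rpredZ //.
by rewrite -quotient_piP quotient_piW.
Qed.

Fact quotient_scaleA a b x :
  quotient_scale a (quotient_scale b x) = quotient_scale (a * b) x.
Proof. by rewrite -[x]quotient_piW -!quotient_piZ scalerA. Qed.

Fact quotient_scale1 : left_id 1 quotient_scale.
Proof. by move=> x; rewrite -[x]quotient_piW -!quotient_piZ scale1r. Qed.

Fact quotient_scaleDr : right_distributive quotient_scale +%R.
Proof.
move=> a x y; rewrite -[x]quotient_piW -[y]quotient_piW.
by rewrite -quotient_piD -!quotient_piZ -quotient_piD scalerDr.
Qed.

Fact quotient_scaleDl x : {morph quotient_scale^~ x : a b / a + b}.
Proof.
move=> a b /=; rewrite -[x]quotient_piW.
by rewrite -!quotient_piZ -quotient_piD scalerDl.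
Qed.

HB.instance Definition _ := GRing.Zmodule_isLmodule.Build R quotient_module
  quotient_scaleA quotient_scale1 quotient_scaleDr quotient_scaleDl.

End QuotientModule.

Section CompositionSeries.
Variables (R : nzRingType).

Definition mod_iso (M N : lmodType R) : Prop :=
  exists f : {linear M -> N}, bijective f.

Definition simple_module (M : lmodType R) : Prop :=
  (exists x : M, x != 0) /\
  forall S : submodClosed M, S =i pred1 0 \/ S =i predT.

Section Restrict.
Variables (M : lmodType R) (S T : submodClosed M).

(* The intersection of S and T, as a submodule of S. *)
Definition restrict_submodule : {pred submodule S} :=
  fun x => submodule_val x \in T.

Fact restrict_submodule_closed : submod_closed restrict_submodule.
Proof.
split=> [|a x y xT yT]; first by rewrite unfold_in rpred0.
by rewrite unfold_in /= rpredD // rpredZ.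
Qed.

HB.instance Definition _ :=
  GRing.isSubmodClosed.Build R (submodule S) restrict_submodule
    restrict_submodule_closed.

Definition subquotient : lmodType R := quotient_module restrict_submodule.

End Restrict.

Variable M : lmodType R.

Definition composition_factor (S : nat -> submodClosed M) (i : nat) :
    lmodType R :=
  subquotient (S i.+1) (S i).

(* S is indexed by nat for convenience; only S 0, ..., S m are constrained. *)
Definition composition_series (m : nat) (S : nat -> submodClosed M) : Prop :=
  [/\ S 0 =i pred1 0, S m =i predT &
    forall i, (i < m)%N ->
      {subset S i <= S i.+1} /\ simple_module (composition_factor S i)].

Definition has_length (m : nat) : Prop :=
  (exists S, composition_series m S) /\
  forall m' S, composition_series m' S -> m' = m.

(* Up to a permutation, the factors of every composition series with m steps  *)
(* are isomorphic to the N i; has_length M m gives such a series.             *)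
Definition composition_factors_are (m : nat) (N : 'I_m -> lmodType R) : Prop :=
  forall S, composition_series m S ->
  exists s : 'S_m, forall i : 'I_m, mod_iso (composition_factor S i) (N (s i)).

End CompositionSeries.

Section Similar.
Variables (A : nzRingType) (a : A).

Definition left_multiples : {pred A^o} := fun p => `[< exists q : A, p = q * a >].

Fact left_multiples_closed : submod_closed left_multiples.
Proof.
split=> [|c x y]; first by apply/asboolP; exists 0; rewrite mul0r.
move=> /asboolP[p ->] /asboolP[q ->]; apply/asboolP; exists (c * p + q).
by rewrite mulrDl -mulrA.
Qed.

HB.instance Definition _ :=
  GRing.isSubmodClosed.Build A A^o left_multiples left_multiples_closed.

Definition cyclic_module : lmodType A := quotient_module left_multiples.

End Similar.

Definition similar_elements (A : nzRingType) (a b : A) : Prop :=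
  mod_iso (cyclic_module a) (cyclic_module b).

Notation "{ 'freealg' K [ n ] }" := {malg K[{fmonom 'I_n}]}
  (at level 0, K, n at level 2, format "{ 'freealg'  K [ n ] }") : type_scope.

Section FreeAlgebra.
Variables (K : fieldType) (n : nat).
Local Notation Lambda := {freealg K[n]}.
Implicit Types (p q a lam : Lambda) (i : 'I_n) (m w : {fmonom 'I_n}).

Definition const_term p : K := p@_mone.

Definition freealg_var i : Lambda := << fmu i >>.

(* mmeasure is 1 + the maximal length of a monomial of p, and 0 if p = 0. *)
Definition freealg_degree p : nat := (mmeasure (@fdeg 'I_n) p).-1.

Definition comonic p : Prop := const_term p = 1.

Definition cofactor i p : Lambda :=
  \sum_(m <- msupp p)
    if ohead m == Some i then << p@_m *g FMonom (behead m) >> else 0.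

Lemma mcoeff_cofactor i p w : (cofactor i p)@_w = p@_(FMonom (i :: w)).
Proof.
rewrite /cofactor raddf_sum /=.
pose F m := if m == FMonom (i :: w) then p@_m else 0.
rewrite (eq_bigr F) => [|m _]; last first.
  rewrite /F; case: m => [[|j s]] //=; first by rewrite mcoeff0.
  rewrite fmP /= eqseq_cons (inj_eq Some_inj); case: eqP => [->|_] /=.
    by rewrite mcoeffU fmP /=; case: eqP.
  by rewrite mcoeff0.
have [wp|wNp] := boolP (FMonom (i :: w) \in msupp p).
  rewrite (big_fsetD1 _ wp) /= {1}/F eqxx big1_fset ?addr0 // => m.
  by rewrite !inE /F => /andP[/negPf->].
rewrite mcoeff_outdom // big1_fset // => m mp _.
by rewrite /F; case: eqP => // em; rewrite -em mp in wNp.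
Qed.

Lemma mcoeff_varM i p w :
  (freealg_var i * p)@_w =
  if ohead w == Some i then p@_(FMonom (behead w)) else 0.
Proof.
rewrite malgM_def fgmulUg raddf_sum /=.
pose F m := if fmmul (fmu i) m == w then p@_m else 0.
rewrite (eq_bigr F) => [|m _]; last first.
  by rewrite mcoeffU mul1r /F; case: eqP.
case: w @F => [[|j s]] F /=.
  by rewrite big1_fset // => m _ _; rewrite /F fmmulE fmuE fmP.
rewrite (inj_eq Some_inj); case: eqP => [e_ji|ne_ji]; last first.
  rewrite big1_fset // => m _ _; rewrite /F fmmulE fmuE fmP /= eqseq_cons.
  by case: eqP => // /esym.
subst j.
have [sp|sNp] := boolP (FMonom s \in msupp p).
  rewrite (big_fsetD1 _ sp) /= {1}/F fmmulE fmuE eqxx big1_fset ?addr0 // => m.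
  rewrite !inE fmP => /andP[m_s _] _; rewrite /F fmmulE fmuE fmP /= eqseq_cons.
  by rewrite (negPf m_s) andbF.
rewrite mcoeff_outdom // big1_fset // => m mp _.
rewrite /F fmmulE fmuE fmP /= eqseq_cons eqxx /=; case: eqP => // em.
by rewrite -em fmK mp in sNp.
Qed.

Lemma cofactor_decomposition p :
  p = (const_term p)%:MP + \sum_(i < n) freealg_var i * cofactor i p.
Proof.
apply/malgP => w; rewrite mcoeffD raddf_sum /= mcoeffC /const_term.
rewrite (eq_bigr _ (fun i _ => mcoeff_varM i _ w)).
case: w => [[|j s]] /=.
  rewrite big1 // addr0; have <- : mone = FMonom [::] :> {fmonom 'I_n}.
    exact: fmoneE.
  by rewrite eqxx.
have -> : (FMonom (j :: s) == mone) = false.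
  by rewrite (fmoneE 'I_n : mone = _) fmP.
rewrite add0r (bigD1 j) //= eqxx mcoeff_cofactor big1 ?addr0 // => i.
by rewrite (inj_eq Some_inj) eq_sym => /negPf->.
Qed.

Lemma cofactor_unique p (k : K) (q : 'I_n -> Lambda) :
  p = k%:MP + \sum_(i < n) freealg_var i * q i ->
  k = const_term p /\ forall i, q i = cofactor i p.
Proof.
move=> def_p; split=> [|i].
  rewrite /const_term def_p mcoeffD mcoeffC eqxx raddf_sum /= big1 ?addr0 //.
  by move=> i _; rewrite mcoeff_varM fm1.
apply/malgP => w; rewrite mcoeff_cofactor def_p mcoeffD mcoeffC.
have -> : (FMonom (i :: w) == mone) = false.
  by rewrite (fmoneE 'I_n : mone = _) fmP.
rewrite add0r raddf_sum (bigD1 i) //.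
rewrite -[RHS]/((freealg_var i * q i)@_(FMonom (i :: w)) + _).
rewrite mcoeff_varM /= eqxx fmK.
rewrite big1 ?addr0 // => j; rewrite mcoeff_varM /= (inj_eq Some_inj) eq_sym.
by move=> /negPf->.
Qed.

Lemma cofactorD i : {morph cofactor i : p q / p + q}.
Proof.
move=> p q; apply/malgP => w.
rewrite mcoeff_cofactor (mcoeffD _ p) mcoeffD.
by congr (_ + _); exact/esym/mcoeff_cofactor.
Qed.

Lemma cofactorZ i c p : cofactor i (c *: p) = c *: cofactor i p.
Proof.
apply/malgP => w.
by rewrite mcoeff_cofactor (mcoeffZ c p) mcoeffZ mcoeff_cofactor. Qed.

Lemma cofactor_sum i (I : Type) (r : seq I) (F : I -> Lambda) :
  cofactor i (\sum_(x <- r) F x) = \sum_(x <- r) cofactor i (F x).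
Proof.
apply: (big_morph _ (cofactorD i)).
by apply/malgP => w; rewrite mcoeff_cofactor !mcoeff0.
Qed.

(* If b is the monomial x_i1 ... x_il, this is (...(p_{x_i1})...)_{x_il}. *)
Definition iter_cofactor p (b : {fmonom 'I_n}) : Lambda :=
  foldl (fun q i => cofactor i q) p b.

Lemma iter_cofactor_rcons p (b : {fmonom 'I_n}) i :
  iter_cofactor p (FMonom (rcons b i)) = cofactor i (iter_cofactor p b).
Proof. by rewrite /iter_cofactor foldl_rcons. Qed.

Definition star lam i a : Lambda :=
  - (const_term a * (const_term lam)^-1) *: cofactor i lam + cofactor i a.

Definition star_monomial lam m a : Lambda := foldr (star lam) a m.

Definition star_action lam p a : Lambda :=
  \sum_(m <- msupp p) p@_m *: star_monomial lam m a.

(* Lambda, with x_i acting by star lam i. This is a module for every lam since *)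
(* 0^-1 = 0 in K, but it is the intended one only if const_term lam != 0.      *)
Definition star_module lam : Type := Lambda.
HB.instance Definition _ lam := GRing.Zmodule.copy (star_module lam) Lambda.

Section StarModule.
Variable lam : Lambda.

Lemma starD i : {morph star lam i : a b / a + b}.
Proof.
move=> a b; rewrite /star cofactorD /const_term mcoeffD mulrDl opprD scalerDl.
by rewrite addrACA.
Qed.

Lemma starZ i c a : star lam i (c *: a) = c *: star lam i a.
Proof.
by rewrite /star cofactorZ /const_term mcoeffZ scalerDr scalerA mulrN mulrA.
Qed.

Lemma star_monomialD m : {morph star_monomial lam m : a b / a + b}.
Proof.
move=> a b; rewrite /star_monomial.
by elim: (fmonom_val m) => //= i s ->; exact: starD.
Qed.

Lemma star_monomialZ m c a :
  star_monomial lam m (c *: a) = c *: star_monomial lam m a.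
Proof.
rewrite /star_monomial.
by elim: (fmonom_val m) => [|i s /= ->]; [reflexivity | exact: starZ].
Qed.

Lemma star_monomial0 m : star_monomial lam m 0 = 0.
Proof. by rewrite -[0 in LHS](scale0r 0) star_monomialZ scale0r. Qed.

Lemma star_monomial_sum m (I : Type) (r : seq I) (F : I -> Lambda) :
  star_monomial lam m (\sum_(i <- r) F i) =
  \sum_(i <- r) star_monomial lam m (F i).
Proof. exact: (big_morph _ (star_monomialD m) (star_monomial0 m)). Qed.

Lemma star_monomialM m1 m2 a :
  star_monomial lam (mmul m1 m2) a =
  star_monomial lam m1 (star_monomial lam m2 a).
Proof. by rewrite /star_monomial fmM foldr_cat. Qed.

Lemma star_actionEw (d : {fset {fmonom 'I_n}}) p a : (msupp p `<=` d)%fset ->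
  star_action lam p a = \sum_(m <- d) p@_m *: star_monomial lam m a.
Proof.
move=> le_d; apply: big_fset_incl => // m _ /mcoeff_outdom ->.
by rewrite scale0r.
Qed.

Lemma star_actionU c m a :
  star_action lam << c *g m >> a = c *: star_monomial lam m a.
Proof. by rewrite (star_actionEw _ msuppU_le) big_seq_fset1 mcoeffUU. Qed.

Fact star_actionDl a : {morph star_action lam ^~ a : p q / p + q}.
Proof.
move=> p q /=; rewrite (star_actionEw _ (msuppD_le p q)).
rewrite (star_actionEw _ (fsubsetUl (msupp p) (msupp q))).
rewrite (star_actionEw _ (fsubsetUr (msupp p) (msupp q))) -big_split /=.
by apply: eq_bigr => m _; rewrite mcoeffD scalerDl.
Qed.

Fact star_actionDr : right_distributive (star_action lam) +%R.
Proof.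
move=> p a b; rewrite -big_split; apply: eq_bigr => m _.
by rewrite star_monomialD scalerDr.
Qed.

Fact star_action1 : left_id 1 (star_action lam).
Proof. by move=> a; rewrite star_actionU scale1r /star_monomial fm1. Qed.

Lemma star_action_sum a (I : Type) (r : seq I) (F : I -> Lambda) :
  star_action lam (\sum_(i <- r) F i) a = \sum_(i <- r) star_action lam (F i) a.
Proof.
apply: (big_morph (star_action lam ^~ a)); first exact: star_actionDl.
by rewrite /star_action msupp0 big_seq_fset0.
Qed.

Fact star_actionA p q a :
  star_action lam p (star_action lam q a) = star_action lam (p * q) a.
Proof.
rewrite malgME star_action_sum; apply: eq_bigr => m1 _.
rewrite star_action_sum star_monomial_sum scaler_sumr; apply: eq_bigr => m2 _.
by rewrite star_actionU star_monomialM star_monomialZ scalerA.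
Qed.

HB.instance Definition _ := GRing.Zmodule_isLmodule.Build Lambda
  (star_module lam) star_actionA star_action1 star_actionDr star_actionDl.

Lemma star_module_varE i (a : star_module lam) :
  freealg_var i *: a = star lam i a :> Lambda.
Proof. by rewrite [LHS]star_actionU scale1r /star_monomial fmuE. Qed.

Lemma star_module_constE (c : K) (a : star_module lam) :
  c%:MP *: a = c *: (a : Lambda) :> Lambda.
Proof. by rewrite [LHS]star_actionU /star_monomial fm1. Qed.

(* The K-span of the cofactors of lam by the monomials b of length >= 1. *)
Definition cofactor_span : {pred star_module lam} := fun v =>
  `[< exists r : seq (K * {fmonom 'I_n}),
        all (fun cb => 0 < fdeg cb.2)%N r /\
        v = \sum_(cb <- r) cb.1 *: iter_cofactor lam cb.2 >].

Lemma cofactor_spanP (v : Lambda) :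
  reflect (exists r : seq (K * {fmonom 'I_n}),
             all (fun cb => 0 < fdeg cb.2)%N r /\
             v = \sum_(cb <- r) cb.1 *: iter_cofactor lam cb.2)
    (v \in cofactor_span).
Proof. exact: asboolP. Qed.

Lemma cofactor_span0 : (0 : Lambda) \in cofactor_span.
Proof. by apply/cofactor_spanP; exists [::]; rewrite big_nil. Qed.

Lemma cofactor_spanD (u v : Lambda) :
  u \in cofactor_span -> v \in cofactor_span -> u + v \in cofactor_span.
Proof.
move=> /cofactor_spanP[r [r1 ->]] /cofactor_spanP[s [s1 ->]].
by apply/cofactor_spanP; exists (r ++ s); rewrite all_cat r1 s1 big_cat.
Qed.

Lemma cofactor_spanZ c (v : Lambda) :
  v \in cofactor_span -> c *: v \in cofactor_span.
Proof.
move=> /cofactor_spanP[r [r1 ->]]; apply/cofactor_spanP.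
exists [seq (c * cb.1, cb.2) | cb <- r]; rewrite all_map; split=> //.
by rewrite big_map scaler_sumr; apply: eq_bigr => cb _; rewrite scalerA.
Qed.

Lemma cofactor_span_sum (I : Type) (r : seq I) (F : I -> Lambda) :
  (forall x, F x \in cofactor_span) -> \sum_(i <- r) F i \in cofactor_span.
Proof.
move=> FV; elim/big_ind: _ => //; first exact: cofactor_span0.
exact: cofactor_spanD.
Qed.

Lemma iter_cofactor_span (b : {fmonom 'I_n}) :
  (0 < fdeg b)%N -> iter_cofactor lam b \in cofactor_span.
Proof.
move=> b1; apply/cofactor_spanP; exists [:: (1, b)].
by rewrite big_seq1 /= b1 scale1r.
Qed.

Lemma star_span i (v : Lambda) :
  v \in cofactor_span -> star lam i v \in cofactor_span.
Proof.
move=> /cofactor_spanP[r [r1 ->]]; apply: cofactor_spanD.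
  apply: cofactor_spanZ.
  by have := @iter_cofactor_span (FMonom [:: i]); apply.
pose F (cb : K * {fmonom 'I_n}) := (cb.1, FMonom (rcons cb.2 i)).
apply/cofactor_spanP; exists [seq F cb | cb <- r].
split; first by rewrite all_map; apply/allP => cb _ /=; rewrite fdegE size_rcons.
rewrite big_map cofactor_sum; apply: eq_bigr => cb _.
by rewrite cofactorZ iter_cofactor_rcons.
Qed.

Fact cofactor_span_closed : submod_closed cofactor_span.
Proof.
split=> [|p u v uV vV]; first exact: cofactor_span0.
apply: cofactor_spanD vV; apply: cofactor_span_sum => m; apply: cofactor_spanZ.
by case: m => m; elim: m => //= i m IHm; apply: star_span.
Qed.

HB.instance Definition _ :=
  GRing.isSubmodClosed.Build Lambda (star_module lam) cofactor_span
    cofactor_span_closed.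

Definition cofactor_module : lmodType Lambda := submodule cofactor_span.

End StarModule.

End FreeAlgebra.

(* Main.v *)
Require Import Defs.
From HB Require Import structures.
From mathcomp Require Import all_boot all_algebra perm generic_quotient.
From mathcomp Require Import monalg boolp.

(* Right multiplication by q maps Lambda_p to Lambda_(pq), the two actions     *)
(* star_(pq) and star_q agree modulo Lambda q, and V_q meets Lambda q only in 0 *)
(* for degree reasons.  Hence V_(pq) = V_p q + V_q, with V_p q isomorphic to    *)
(* V_p and V_(pq) / V_p q to V_q; so a factorization of lam into irreducibles   *)
(* gives a composition series of V_lam once (1) is known.  For (1), if W is a   *)
(* submodule of V_lam then the left ideal W + K lam is principal, and its       *)
(* generator is a right factor of lam.  For (3), both isomorphisms amount to    *)
(* elements a, b with lam a in Lambda gam, gam b in Lambda lam, and a, b        *)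
(* inverse to each other modulo lam and gam.  Such an a acts from V_lam to      *)
(* V_gam by right multiplication modulo Lambda gam; conversely a is the image   *)
(* of 1, which generates V_lam.                                                 *)

Set Implicit Arguments.
Unset Strict Implicit.
Unset Printing Implicit Defensive.

Import GRing.Theory.

Local Open Scope ring_scope.

(** Let [A] be the free algebra, and let [l], [p], [q], [g] have nonzero constant term. Three facts
    carry the proof. By degree, [V_l] meets [A l] only in 0 ([cofactors_ideal]). The product rule
    for cofactors gives [V_(pq) = V_p q + V_q] ([cofactors_mul_left], [cofactors_mul_right],
    [cofactors_mulP]); the delicate inclusion of [V_q] in [V_(pq)] rests on a Nakayama-type
    induction, possible because iterated cofactors eventually vanish ([nakayama], [stable_product]).
    Finally, if [l a] lies in [A g], right multiplication by [a] carries the action of [l] to that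
    of [g] modulo [A g] ([act_right_mul]).

    (1) If [l = p q] with non-units [p], [q], then [V_p q] is a nonzero proper submodule of [V_l].
    Conversely, for a submodule [W] the space [W + K l] is a left ideal [A r], so [l = p r]; if [r]
    is a unit then [W = V_l], and if [p] is a unit then [W = 0] ([act_stable_ideal]).

    (2) For [lam = pi_1 ... pi_m], intersecting [V_lam] with the left ideals generated by shorter
    and shorter suffixes of the product gives a chain from 0 to [V_lam] whose factors are the
    [V_(pi_i)] ([irreducible_series]), simple by (1). The Jordan-Hoelder theorem, proved for
    arbitrary modules, gives uniqueness.

    (3) Both isomorphisms amount to a [similarity_pair]. On cyclic modules [a] and [b] come from the
    images of 1 under the isomorphism and its inverse ([cyclic_iso_pair]). On the other side 1
    generates [V_l], and any isomorphism onto [V_g] is right multiplication by the image of 1 modulo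
    [A g] ([act_relation_mul]); conversely such a multiplication maps [V_l] into [V_g + A g]
    ([mul_relation_total]). *)

Section ModuleIsomorphisms.
Variable R : nzRingType.
Implicit Types M N P : lmodType R.

(** * Isomorphisms given by relations; submodules and subquotients *)

Definition linear_relation M N (Q : M -> N -> Prop) : Prop :=
  forall a x x' y y', Q x y -> Q x' y' -> Q (a *: x + x') (a *: y + y').

(** Subtracting two pairs with a common entry leaves a pair with entry 0, so the relation is
    functional both ways and is the graph of a bijection. Relations spare the choice of
    representatives when a map is only determined modulo a submodule or an ideal. *)
Lemma mod_iso_rel M N (Q : M -> N -> Prop) : linear_relation Q ->
  (forall x, exists y, Q x y) -> (forall y, exists x, Q x y) ->
  (forall x y, Q x y -> (x = 0 <-> y = 0)) -> mod_iso M N.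
Proof.
move=> linQ totl totr Q0.
have Qfun x y y' : Q x y -> Q x y' -> y = y'.
  move=> Qy Qy'; have := linQ (-1) _ _ _ _ Qy Qy'.
  rewrite !scaleN1r addNr => /Q0[/(_ erefl) /eqP + _].
  by rewrite addrC subr_eq0 => /eqP.
have Qinj x x' y : Q x y -> Q x' y -> x = x'.
  move=> Qx Qx'; have := linQ (-1) _ _ _ _ Qx Qx'.
  rewrite !scaleN1r addNr => /Q0[_ /(_ erefl) /eqP].
  by rewrite addrC subr_eq0 => /eqP.
pose f x := projT1 (cid (totl x)); pose g y := projT1 (cid (totr y)).
have fP x : Q x (f x) by rewrite /f; case: cid.
have gP y : Q (g y) y by rewrite /g; case: cid.
have linf : linear f.
  by move=> a x y; apply: (Qfun (a *: x + y)) => //; apply: linQ.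
pose F : {linear M -> N} := HB.pack f (GRing.isLinear.Build R M N *:%R f linf).
exists F.
exists g => z /=; first exact: (Qinj _ _ (f z)).
exact: (Qfun (g z)).
Qed.

Lemma mod_iso_sym M N : mod_iso M N -> mod_iso N M.
Proof.
case=> f [g fK gK]; apply: (@mod_iso_rel _ _ (fun y x => y = f x)).
- by move=> a y y' x x' -> ->; rewrite linearP.
- by move=> y; exists (g y).
- by move=> x; exists (f x).
move=> y x ->; split=> [fx0|->]; last exact: linear0.
by rewrite -(fK x) fx0 -(linear0 f) fK.
Qed.

Lemma mod_iso_trans M N P : mod_iso M N -> mod_iso N P -> mod_iso M P.
Proof.
case=> f bijf [g bijg]; exists (g \o f : {linear M -> P})%FUN.
exact: bij_comp.
Qed.

Lemma simple_mod_iso M N : mod_iso M N -> simple_module M -> simple_module N.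
Proof.
case=> f [g fK gK] [[x x0] simM]; split.
  by exists (f x); apply: contra_neq x0 => fx0; rewrite -(fK x) fx0 -(linear0 f) fK.
move=> S; pose s : {pred M} := fun x => f x \in S.
have s_closed : submod_closed s.
  split=> [|a u v uS vS]; rewrite unfold_in ?linear0 ?rpred0 //.
  by rewrite linearP rpredD // rpredZ.
pose s' : submodClosed M :=
  HB.pack s (GRing.isSubmodClosed.Build R M s s_closed).
have [s0|sT] := simM s'.
  left=> y; rewrite -(gK y) -[LHS]/(g y \in s) (s0 (g y)) !inE.
  by apply/eqP/eqP=> [->|fg0]; [exact: linear0|rewrite -(gK y) fg0 -(linear0 f) fK].
by right=> y; rewrite -(gK y) -[LHS]/(g y \in s) (sT (g y)).
Qed.

Lemma submodule_of_prop M (P : M -> Prop) : P 0 ->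
  (forall a x y, P x -> P y -> P (a *: x + y)) ->
  exists S : submodClosed M, forall x, (x \in S) <-> P x.
Proof.
move=> P0 Plin; pose s : {pred M} := fun x => `[< P x >].
have s_closed : submod_closed s.
  by split=> [|a u v /asboolP uP /asboolP vP]; apply/asboolP; [|apply: Plin].
pose s' : submodClosed M :=
  HB.pack s (GRing.isSubmodClosed.Build R M s s_closed).
exists s' => x.
by split=> /asboolP.
Qed.

Section Subquotient.
Variables (M : lmodType R) (S T : submodClosed M).

Definition subquotient_class x (xS : x \in S) : subquotient S T :=
  @quotient_pi R (submodule S) (@restrict_submodule R M S T) (Submodule xS).

Lemma subquotient_classP (y : subquotient S T) :
  exists x (xS : x \in S), y = subquotient_class xS.
Proof.
rewrite -(quotient_piW y); case: (repr _) => x xS.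
by exists x, xS.
Qed.

Lemma subquotient_class_eq x y (xS : x \in S) (yS : y \in S) :
  subquotient_class xS = subquotient_class yS <-> x - y \in T.
Proof.
by split=> [/eqP|xyT]; [|apply/eqP]; rewrite /subquotient_class quotient_piP.
Qed.

Lemma subquotient_class_eq0 x (xS : x \in S) :
  subquotient_class xS = 0 <-> x \in T.
Proof.
have <- : subquotient_class (rpred0 S) = 0.
  apply: (addrI (subquotient_class (rpred0 S))).
  rewrite addr0 /subquotient_class -quotient_piD.
  by congr quotient_pi; apply: val_inj; rewrite /= addr0.
by rewrite subquotient_class_eq subr0.
Qed.

Lemma subquotient_class_linear a x y (xS : x \in S) (yS : y \in S)
    (axyS : a *: x + y \in S) :
  a *: subquotient_class xS + subquotient_class yS = subquotient_class axyS.
Proof.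
rewrite /subquotient_class -[_ *: _]quotient_piZ -quotient_piD.
by congr quotient_pi; apply: val_inj.
Qed.

End Subquotient.

End ModuleIsomorphisms.

Section CompositionFactors.
Variable R : nzRingType.

Lemma subquotient_iso (M M' : lmodType R) (S T : submodClosed M)
    (S' T' : submodClosed M') (Q : M -> M' -> Prop) :
  linear_relation Q ->
  (forall x, x \in S -> exists2 y, y \in S' & Q x y) ->
  (forall y, y \in S' -> exists2 x, x \in S & Q x y) ->
  (forall x y, x \in S -> y \in S' -> Q x y -> (x \in T <-> y \in T')) ->
  mod_iso (subquotient S T) (subquotient S' T').
Proof.
move=> linQ totl totr Q0.
pose Q' (u : subquotient S T) (v : subquotient S' T') := exists x y,
  exists (xS : x \in S) (yS : y \in S'),
  [/\ u = subquotient_class T xS, v = subquotient_class T' yS & Q x y].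
apply: (@mod_iso_rel _ _ _ Q').
- move=> a _ _ _ _ [x [y [xS [yS [-> -> Qxy]]]]] [z [t [zS [tS [-> -> Qzt]]]]].
  have xzS : a *: x + z \in S by rewrite rpredD ?rpredZ.
  have ytS : a *: y + t \in S' by rewrite rpredD ?rpredZ.
  exists (a *: x + z), (a *: y + t), xzS, ytS.
  by rewrite -!subquotient_class_linear; split=> //; apply: linQ.
- move=> u; have [x [xS ->]] := subquotient_classP u.
  have [y yS Qxy] := totl x xS; exists (subquotient_class T' yS).
  by exists x, y, xS, yS.
- move=> u; have [y [yS ->]] := subquotient_classP u.
  have [x xS Qxy] := totr y yS; exists (subquotient_class T xS).
  by exists x, y, xS, yS.
move=> _ _ [x [y [xS [yS [-> -> Qxy]]]]].
by rewrite !subquotient_class_eq0; apply: Q0.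
Qed.

Lemma subquotient_submodule_iso (M M' : lmodType R) (S T : submodClosed M)
    (S' : submodClosed M') (Q : M -> M' -> Prop) :
  linear_relation Q ->
  (forall x, x \in S -> exists2 y, y \in S' & Q x y) ->
  (forall y, y \in S' -> exists2 x, x \in S & Q x y) ->
  (forall x y, x \in S -> y \in S' -> Q x y -> (x \in T <-> y = 0)) ->
  mod_iso (subquotient S T) (submodule S').
Proof.
move=> linQ totl totr Q0.
pose Q' (u : subquotient S T) (v : submodule S') := exists x,
  exists (xS : x \in S), u = subquotient_class T xS /\ Q x (submodule_val v).
apply: (@mod_iso_rel _ _ _ Q').
- move=> a _ _ y t [x [xS [-> Qxy]]] [z [zS [-> Qzt]]].
  have xzS : a *: x + z \in S by rewrite rpredD ?rpredZ.
  exists (a *: x + z), xzS.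
  by rewrite -subquotient_class_linear; split=> //; apply: linQ.
- move=> u; have [x [xS ->]] := subquotient_classP u.
  have [y yS Qxy] := totl x xS; exists (Submodule yS).
  by exists x, xS.
- case=> y yS; have [x xS Qxy] := totr y yS; exists (subquotient_class T xS).
  by exists x, xS.
move=> _ y [x [xS [-> Qxy]]].
rewrite subquotient_class_eq0 (Q0 x (submodule_val y)) ?(valP y) //.
by split=> [y0|->]; first exact: val_inj.
Qed.

Lemma submodule_iso (M M' : lmodType R) (S : submodClosed M)
    (S' : submodClosed M') (Q : M -> M' -> Prop) :
  linear_relation Q ->
  (forall x, x \in S -> exists2 y, y \in S' & Q x y) ->
  (forall y, y \in S' -> exists2 x, x \in S & Q x y) ->
  (forall x y, x \in S -> y \in S' -> Q x y -> (x = 0 <-> y = 0)) ->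
  mod_iso (submodule S) (submodule S').
Proof.
move=> linQ totl totr Q0.
apply: (@mod_iso_rel _ _ _ (fun u v => Q (submodule_val u) (submodule_val v))).
- by move=> a x x' y y'; apply: linQ.
- by case=> x xS; have [y yS Qxy] := totl x xS; exists (Submodule yS).
- by case=> y yS; have [x xS Qxy] := totr y yS; exists (Submodule xS).
move=> x y /(Q0 _ _ (valP x) (valP y)) xy0.
split=> [x0|y0]; apply: val_inj; first by apply: xy0.1; rewrite x0.
by apply: xy0.2; rewrite y0.
Qed.

(** This moves simplicity from the subtype [submodule S] to predicates on the ambient module, where
    the cofactor arguments take place. *)
Lemma simple_submoduleP (M : lmodType R) (S : submodClosed M) :
  simple_module (submodule S) <->
  (exists2 x, x \in S & x != 0) /\
  forall P : M -> Prop, P 0 -> (forall a x y, P x -> P y -> P (a *: x + y)) ->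
    (forall x, P x -> x \in S) ->
    (forall x, P x -> x = 0) \/ (forall x, x \in S -> P x).
Proof.
split=> [[[x x0] simS]|[[x xS x0] simS]]; split.
- by exists (submodule_val x); [exact: valP|].
- move=> P P0 Plin PS.
  have [||W WP] := @submodule_of_prop R (submodule S) (fun u => P (submodule_val u)).
  + exact: P0.
  + by move=> a u v; apply: Plin.
  have [W0|WT] := simS W; [left=> y Py|right=> y yS].
    have : Submodule (PS y Py) \in W by apply/WP.
    by rewrite W0 inE => /eqP/(congr1 val).
  exact: ((WP (Submodule yS)).1 (WT _)).
- by exists (Submodule xS); apply: contra_neq x0 => /(congr1 val).
move=> W; have [||y [yS yW]|W0|WT] := 
  simS (fun y => exists yS : y \in S, Submodule yS \in W).
- by exists (rpred0 S); rewrite (_ : Submodule _ = 0) ?rpred0 //; apply: val_inj.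
- move=> a y z [yS yW] [zS zW].
  have ayzS : a *: y + z \in S by rewrite rpredD ?rpredZ.
  exists ayzS; rewrite (_ : Submodule _ = a *: Submodule yS + Submodule zS).
    by rewrite rpredD ?rpredZ.
  exact: val_inj.
- exact: yS.
- left=> -[y yS]; rewrite inE; apply/idP/eqP=> [yW|->]; last exact: rpred0.
  by apply: val_inj; apply: W0; exists yS.
right=> -[y yS]; have [yS' yW] := WT y yS.
by rewrite (_ : Submodule yS = Submodule yS') //; apply: val_inj.
Qed.

(** The elements of [S] satisfying [P] have a nonzero image in the simple module [subquotient S T],
    so this image is everything. *)
Lemma simple_subquotient (M : lmodType R) (S T : submodClosed M) (P : M -> Prop) :
  simple_module (subquotient S T) ->
  P 0 -> (forall a x y, P x -> P y -> P (a *: x + y)) ->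
  (exists z, [/\ z \in S, P z & z \notin T]) ->
  forall x, x \in S -> exists z, [/\ z \in S, P z & x - z \in T].
Proof.
move=> [_ simS] P0 Plin [z [zS Pz zT]] x xS.
have [||W WP] := @submodule_of_prop R (subquotient S T)
  (fun u => exists y, exists2 yS : y \in S, P y & u = subquotient_class T yS).
- exists 0, (rpred0 S) => //; apply/esym/subquotient_class_eq0; exact: rpred0.
- move=> a _ _ [y [yS Py ->]] [t [tS Pt ->]].
  have aytS : a *: y + t \in S by rewrite rpredD ?rpredZ.
  exists (a *: y + t), aytS; first exact: Plin.
  exact: subquotient_class_linear.
have [W0|WT] := simS W.
  have : subquotient_class T zS \in W by apply/WP; exists z, zS.
  rewrite W0 inE => /eqP/subquotient_class_eq0.
  by rewrite (negPf zT).
have /WP[y [yS Py /subquotient_class_eq xyT]] := WT (subquotient_class T xS).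
by exists y.
Qed.

Lemma simple_subquotient_neq (M : lmodType R) (S T : submodClosed M) :
  simple_module (subquotient S T) -> exists2 x, x \in S & x \notin T.
Proof.
case=> -[u u0] _; move: u0; have [x [xS ->]] := subquotient_classP u => x0.
exists x => //; apply: contraNN x0 => xT; apply/eqP.
exact/subquotient_class_eq0.
Qed.

End CompositionFactors.

(** * The Jordan-Hoelder theorem *)

Section JordanHoelder.
Variables (R : nzRingType) (M : lmodType R).

Lemma submod_congr (S : submodClosed M) x y :
  x - y \in S -> (x \in S) = (y \in S).
Proof.
move=> xyS; apply/idP/idP=> [xS|yS]; last by rewrite -(subrK y x) rpredD.
by rewrite -(subKr x y) -scaleN1r addrC rpredD // rpredZ.
Qed.

Implicit Types S T : nat -> submodClosed M.

(* T j.+1 is the first term of T whose intersection with S i.+1 leaves S i.   *)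
(* This relation is symmetric, so it matches the factors of S with those of T. *)
Definition linked S T (i j : nat) : Prop :=
  (exists z, [/\ z \in S i.+1, z \in T j.+1 & z \notin S i]) /\
  forall z, z \in S i.+1 -> z \in T j -> z \in S i.

(** If some [y] in [T j.+1] and [S i] were outside [T j], simplicity would give [w] in [S i]
    congruent to [z] modulo [T j]. Then [z - w] lies in [S i.+1] and [T j], hence in [S i], and so
    does [z], a contradiction. *)
Lemma linked_sym S T i j :
  {subset S i <= S i.+1} -> simple_module (composition_factor T j) ->
  linked S T i j -> linked T S j i.
Proof.
move=> Si simT [[z [zS zT zNS]] STj]; split=> [|y yT yS].
  by exists z; split=> //; apply: contraNN zNS; apply: STj.
apply: contraNT zNS => yNT.
have Slin a s t : s \in S i -> t \in S i -> a *: s + t \in S i.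
  by move=> sS tS; rewrite rpredD ?rpredZ.
have ex_y : exists w, [/\ w \in T j.+1, w \in S i & w \notin T j] by exists y.
have [w [wT wS zwT]] := simple_subquotient simT (rpred0 (S i)) Slin ex_y zT.
rewrite -(subrK w z) rpredD //; apply: (STj _ _ zwT).
by rewrite -scaleN1r rpredD // rpredZ //; apply: Si.
Qed.

Lemma linked_exists S T i m :
  simple_module (composition_factor S i) -> T 0%N =i pred1 0 -> T m =i predT ->
  exists2 j, (j < m)%N & linked S T i j.
Proof.
move=> /simple_subquotient_neq[x xS xNS] T0 Tm.
pose P j := `[< exists z, [/\ z \in S i.+1, z \in T j & z \notin S i] >].
have exP : exists j, P j by exists m; apply/asboolP; exists x; rewrite Tm.
have [k Pk mink] := ex_minnP exP; case: k Pk mink => [|j] Pj minj.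
  have /asboolP[z [_ + /negP[]]] := Pj.
  by rewrite T0 => /eqP->; exact: rpred0.
exists j.
  by apply: minj; apply/asboolP; exists x; rewrite Tm.
split=> [|z zS zT]; first exact/asboolP.
apply: contraT => zNS.
by have := minj j; rewrite ltnn => /(_ _)-> //; apply/asboolP; exists z.
Qed.

Lemma linked_uniq S T i j j' m :
  (forall k, (k < m)%N -> {subset T k <= T k.+1}) -> (j < m)%N -> (j' < m)%N ->
  linked S T i j -> linked S T i j' -> j = j'.
Proof.
move=> Tmono; wlog lt_jj' : j j' / (j < j')%N => [wlog_lt|] jm j'm ij ij'.
  by case: (ltngtP j j') => // jj'; [|apply/esym]; apply: wlog_lt.
have Tle d k : (k + d <= m)%N -> {subset T k <= T (k + d)%N}.
  elim: d => [|d IHd]; first by rewrite addn0 => _ z.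
  by rewrite addnS => kdm z /(IHd (ltnW kdm)) /(Tmono _ kdm).
have [[z [zS zT /negP zNS]] _] := ij; case: zNS; apply: ij'.2 => //.
by rewrite -(subnKC lt_jj'); apply: Tle zT; rewrite subnKC // ltnW.
Qed.

(** As in Zassenhaus' lemma, every class of either factor has a representative in both [S i.+1] and
    [T j.+1]; two classes correspond when they share such a representative [z]. By the link and its
    symmetric form, [z] is trivial in one factor exactly when it is in the other. *)
Lemma linked_iso S T i j :
  {subset S i <= S i.+1} -> {subset T j <= T j.+1} ->
  simple_module (composition_factor S i) ->
  simple_module (composition_factor T j) ->
  linked S T i j -> mod_iso (composition_factor S i) (composition_factor T j).
Proof.
move=> Si Tj simS simT ij; have ji := linked_sym Si simT ij.
pose Q x y := exists2 z, z \in S i.+1 /\ z \in T j.+1 & x - z \in S i /\ y - z \in T j.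
have link_ex S' T' i' j' : simple_module (composition_factor S' i') ->
    linked S' T' i' j' -> forall x, x \in S' i'.+1 ->
    exists z, [/\ z \in S' i'.+1, z \in T' j'.+1 & x - z \in S' i'].
  move=> simS' [[z zP] _] x xS; apply: (simple_subquotient simS') => //.
  - exact: rpred0.
  - by move=> a s t sT tT; rewrite rpredD ?rpredZ.
  by exists z.
apply: (@subquotient_iso _ _ _ _ _ _ _ Q).
- move=> a x x' y y' [z [zS zT] [xz yz]] [z' [zS' zT'] [xz' yz']].
  exists (a *: z + z'); first by split; rewrite rpredD ?rpredZ.
  have axD u u' v v' : a *: u + u' - (a *: v + v') = a *: (u - v) + (u' - v') :> M.
    by rewrite opprD addrACA -scalerBr.
  by rewrite !axD; split; rewrite rpredD ?rpredZ.
- move=> x xS; have [z [zS zT xz]] := link_ex _ _ _ _ simS ij x xS.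
  by exists z => //; exists z => //; rewrite subrr rpred0.
- move=> y yT; have [z [zT zS yz]] := link_ex _ _ _ _ simT ji y yT.
  by exists z => //; exists z => //; rewrite subrr rpred0.
move=> x y xS yT [z [zS zT] [xz yz]].
have -> : (x \in S i) = (z \in S i) by exact: submod_congr.
have -> : (y \in T j) = (z \in T j) by exact: submod_congr.
by split; [apply: ji.2|apply: ij.2].
Qed.

Lemma series_matching m m' S T :
  composition_series m S -> composition_series m' T ->
  exists f : 'I_m -> 'I_m', injective f /\
    forall i : 'I_m, mod_iso (composition_factor S i) (composition_factor T (f i)).
Proof.
move=> [S0 Sm Ssim] [T0 Tm' Tsim].
have ex_f (i : 'I_m) : exists j : 'I_m', linked S T i j.
  have [Si simS] := Ssim i (ltn_ord i).
  have [j jm' ij] := linked_exists simS T0 Tm'.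
  by exists (Ordinal jm').
exists (fun i => projT1 (cid (ex_f i))); split=> [i i'|i]; last first.
  case: cid => j ij /=.
  have [Si simS] := Ssim i (ltn_ord i); have [Tj simT] := Tsim j (ltn_ord j).
  exact: linked_iso.
case: cid => j ij; case: cid => j' i'j' /= e; apply: val_inj.
move: i'j'; rewrite -e => i'j.
have [Tj simT] := Tsim j (ltn_ord j).
have [Si _] := Ssim i (ltn_ord i); have [Si' _] := Ssim i' (ltn_ord i').
(* Injectivity is uniqueness with the two series exchanged: only one index of [S] is linked to a
   given index of [T]. *)
apply: (@linked_uniq T S j i i' m); rewrite ?ltn_ord //.
- by move=> k /Ssim[].
- exact: linked_sym ij.
exact: linked_sym i'j.
Qed.

Theorem jordan_hoelder m m' S T :
  composition_series m S -> composition_series m' T -> m = m'.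
Proof.
move=> serS serT; apply/eqP; rewrite eqn_leq.
have [f [f_inj _]] := series_matching serS serT.
have [g [g_inj _]] := series_matching serT serS.
have := leq_card f f_inj; have := leq_card g g_inj.
by rewrite !card_ord => -> ->.
Qed.

Lemma composition_series_length m S : composition_series m S -> has_length M m.
Proof.
move=> serS; split=> [|m' T serT]; first by exists S.
exact: jordan_hoelder serT serS.
Qed.

Lemma composition_series_factors m S (N : 'I_m -> lmodType R) :
  composition_series m S ->
  (forall i : 'I_m, mod_iso (composition_factor S i) (N i)) ->
  composition_factors_are M N.
Proof.
move=> serS SN T serT; have [f [f_inj fP]] := series_matching serT serS.
exists (perm f_inj) => i; rewrite permE.
exact: mod_iso_trans (fP i) (SN _).
Qed.

End JordanHoelder.

(* What the proof needs of the free algebra: the product rule and the local    *)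
(* nilpotence of the cofactor maps.                                            *)
Record cofactorRing (K : fieldType) (I : finType) := CofactorRing {
  cofactor_carrier :> nzRingType;
  scalar : {rmorphism K -> cofactor_carrier};
  constant : {rmorphism cofactor_carrier -> K};
  var : I -> cofactor_carrier;
  cof : I -> {additive cofactor_carrier -> cofactor_carrier};
  scalar_central : forall k a, a * scalar k = scalar k * a;
  constant_scalar : forall k, constant (scalar k) = k;
  cof_scalar : forall i k, cof i (scalar k) = 0;
  cofM : forall i a b, cof i (a * b) = cof i a * b + scalar (constant a) * cof i b;
  cof_decomposition : forall a, a = scalar (constant a) + \sum_i var i * cof i a;
  cof_nilpotent : forall a, exists N, forall w : seq I,
    (N <= size w)%N -> foldl (fun b i => cof i b) a w = 0
}.

(** * Subspaces, left ideals and degree bounds in a cofactor ring *)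

Section CofactorCalculus.
Variables (K : fieldType) (I : finType) (A : cofactorRing K I).
Local Notation c := (scalar A).
Local Notation e := (constant A).
Local Notation x := (@var _ _ A).
Local Notation d := (@cof _ _ A).
Implicit Types (a b p q l g u v w s t : A) (k : K) (i : I) (N : nat).
Implicit Types (P W G : A -> Prop).

Lemma mul_scalarCA a k b : a * (c k * b) = c k * (a * b).
Proof. by rewrite !mulrA scalar_central. Qed.

Lemma cofZ i k a : d i (c k * a) = c k * d i a.
Proof. by rewrite cofM cof_scalar mul0r add0r constant_scalar. Qed.

Definition subspace P : Prop :=
  P 0 /\ forall k a b, P a -> P b -> P (c k * a + b).

Definition cof_stable P : Prop := forall i a, P a -> P (d i a).

Section Subspace.
Variables (P : A -> Prop) (subP : subspace P).

Lemma subspace0 : P 0. Proof. exact: subP.1. Qed.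

Lemma subspaceZ k a : P a -> P (c k * a).
Proof. by move=> Pa; rewrite -[_ * _]addr0; apply: subP.2 => //; exact: subP.1. Qed.

Lemma subspaceD a b : P a -> P b -> P (a + b).
Proof. by move=> Pa Pb; rewrite -[a]mul1r -(rmorph1 c); apply: subP.2. Qed.

Lemma subspaceN a : P a -> P (- a).
Proof. by rewrite -mulN1r -(rmorphN1 c); exact: subspaceZ. Qed.

Lemma subspaceB a b : P a -> P b -> P (a - b).
Proof. by move=> Pa Pb; apply: subspaceD => //; exact: subspaceN. Qed.

Lemma subspace_sum (F : I -> A) : (forall i, P (F i)) -> P (\sum_i F i).
Proof. by move=> PF; elim/big_ind: _ => //; [exact: subspace0|exact: subspaceD]. Qed.

End Subspace.

Definition ideal q v : Prop := exists t, v = t * q.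

Lemma idealM t q : ideal q (t * q). Proof. by exists t. Qed.

Lemma ideal_mull t q v : ideal q v -> ideal q (t * v).
Proof. by case=> s ->; exists (t * s); rewrite mulrA. Qed.

Lemma ideal_subspace q : subspace (ideal q).
Proof.
split=> [|k _ _ [s ->] [t ->]]; first by exists 0; rewrite mul0r.
by exists (c k * s + t); rewrite mulrDl mulrA.
Qed.

Definition image_sum (f : I -> A -> A) G u : Prop :=
  exists2 h : I -> A, forall i, G (h i) & u = \sum_i f i (h i).

Lemma image_sum_subspace (f : I -> A -> A) G :
  (forall i k a b, f i (c k * a + b) = c k * f i a + f i b) -> subspace G ->
  subspace (image_sum f G).
Proof.
move=> flin subG.
have f0 i : f i 0 = 0.
  apply: (addrI (f i 0)); rewrite addr0 -{1}[f i 0]mul1r -{1}(rmorph1 c) -flin.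
  by rewrite mulr0 addr0.
split=> [|k _ _ [h Gh ->] [h' Gh' ->]].
  by exists (fun=> 0) => [i|]; [exact: subspace0|rewrite big1].
exists (fun i => c k * h i + h' i) => [i|]; first exact: subG.2.
by rewrite mulr_sumr -big_split; apply: eq_bigr => i _; rewrite flin.
Qed.

Lemma image_sum_gen (f : I -> A -> A) G i a :
  (forall j, f j 0 = 0) -> G 0 -> G a -> image_sum f G (f i a).
Proof.
move=> f0 G0 Ga; exists (fun j => if j == i then a else 0) => [j|].
  by case: ifP.
by rewrite (bigD1 i) //= eqxx big1 ?addr0 // => j /negPf->.
Qed.

Lemma cof_linear i k a b : d i (c k * a + b) = c k * d i a + d i b.
Proof. by rewrite raddfD /= cofZ. Qed.

(* In the free algebra: every monomial of a has length < N. *)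
Fixpoint bounded N a : Prop :=
  if N is N'.+1 then forall i, bounded N' (d i a) else a = 0.

Lemma bounded_subspace N : subspace (bounded N).
Proof.
elim: N => [|N [B0 Blin]]; first by split=> // k a b -> ->; rewrite mulr0 addr0.
split=> [i|k a b Ba Bb i] /=; first by rewrite raddf0.
by rewrite cof_linear; apply: Blin.
Qed.

Lemma boundedS N a : bounded N a -> bounded N.+1 a.
Proof.
elim: N a => [|N IHN] a Ba i; last by apply: IHN; exact: Ba.
by rewrite Ba /= raddf0.
Qed.

Lemma bounded_le N N' a : (N <= N')%N -> bounded N a -> bounded N' a.
Proof.
move=> /subnK<-; elim: (N' - N)%N => // m IHm /IHm; exact: boundedS.
Qed.

Lemma bounded_stable N : cof_stable (bounded N).
Proof. by case: N => [|N] i a Ba; [rewrite Ba /= raddf0|apply: boundedS]. Qed.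

Lemma bounded_ex a : exists N, bounded N a.
Proof.
have [N] := cof_nilpotent a; exists N.
elim: N a p => [|N IHN] a aN /=; first exact: (aN [::]).
by move=> i; apply: IHN => w wN; apply: (aN (i :: w)).
Qed.

Lemma boundedM N N' p q : bounded N p -> bounded N' q -> bounded (N + N') (p * q).
Proof.
elim: N p => [|N IHN] p Bp Bq /=.
  by rewrite Bp mul0r; exact: subspace0 (bounded_subspace N').
move=> i; rewrite cofM; apply: subspaceD; first exact: bounded_subspace.
  exact: IHN.
apply: subspaceZ; first exact: bounded_subspace.
by apply: (bounded_le (leq_addl N N')); exact: bounded_stable.
Qed.

Lemma bounded1P a : bounded 1 a <-> a = c (e a).
Proof.
split=> [/= da0|-> i]; last exact: cof_scalar.
by rewrite {1}(cof_decomposition a) big1 ?addr0 // => i _; rewrite da0 mulr0.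
Qed.

(** Iterating the decomposition [m] times writes [g], modulo [P], as a sum of [m]-fold cofactors of
    elements of [G], and these vanish once [m] reaches the common bound [N]. Stability of [P]
    absorbs the errors of the earlier rounds. *)
Lemma nakayama P G : subspace P -> cof_stable P ->
  (forall g, G g -> exists2 s, image_sum (fun i => d i) G s & P (g - s)) ->
  (exists N, forall g, G g -> bounded N g) ->
  forall g, G g -> P g.
Proof.
move=> subP stP Gdec [N GN].
have approx m : forall g, G g -> exists2 s, P s & bounded (N - m) (g - s).
  elim: m => [|m IHm] g Gg.
    by exists 0; [exact: subspace0|rewrite subr0 subn0; exact: GN].
  have [_ [h Gh ->] Pg] := Gdec g Gg.
  have ex_r i : exists s, P s /\ bounded (N - m) (h i - s).
    by have [s Ps hs] := IHm (h i) (Gh i); exists s.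
  have [r rP] := choice ex_r.
  set t := \sum_i _ in Pg; exists (g - t + \sum_i d i (r i)).
    by apply: subspaceD => //; apply: subspace_sum => // i; apply: stP; exact: (rP i).1.
  rewrite subnS -[g in bounded _ (g - _)](subrK t g) opprD addrACA subrr add0r.
  rewrite -sumrB; apply: subspace_sum => [|i]; first exact: bounded_subspace.
  (* Subtraction is truncated: when [N - m] is already 0 the element is 0, and so is its
     cofactor. *)
  rewrite -raddfB; case: (N - m)%N (rP i).2 => [|N'] /= hr; last exact: hr.
  by rewrite hr raddf0.
move=> g Gg; have [s Ps] := approx N g Gg.
by rewrite subnn => /subr0_eq->.
Qed.

(** * The space [V_l] of cofactors and its behaviour under products *)

(** This is [V_l] as the least stable subspace containing the [d i l], so that inclusions are proved
    by exhibiting a stable subspace; [cofactor_spanE] identifies it with the span of iterated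
    cofactors. *)
Definition cofactors l v : Prop :=
  forall P, subspace P -> cof_stable P -> (forall i, P (d i l)) -> P v.

Section Cofactors.
Variable l : A.

Lemma cofactors_subspace : subspace (cofactors l).
Proof.
split=> [P subP|k a b la lb P subP stP Pl]; first by move=> _ _; exact: subspace0.
by apply: subP.2; [apply: la|apply: lb].
Qed.
Let subl := cofactors_subspace.

Lemma cofactors_stable : cof_stable (cofactors l).
Proof. by move=> i a la P subP stP Pl; apply: (stP); exact: la. Qed.

Lemma cofactors_cof i : cofactors l (d i l).
Proof. by move=> P _ _. Qed.

Lemma cofactors_bounded N v : bounded N.+1 l -> cofactors l v -> bounded N v.
Proof.
by move=> Bl lv; apply: lv => //; [exact: bounded_subspace|exact: bounded_stable].
Qed.

Lemma cofactors_cst v : l = c (e l) -> cofactors l v -> v = 0.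
Proof. by move=> /bounded1P; exact: cofactors_bounded. Qed.

(** Taking nonzero cofactors of [v] for as long as there are any ends at a nonzero constant. *)
Lemma stable1 P v : subspace P -> cof_stable P -> P v -> v <> 0 -> P 1.
Proof.
move=> subP stP; have [N] := bounded_ex v.
elim: N v => // N IHN v Bv Pv v0.
have [dv0|/existsNP[i di0]] := EM (forall i, d i v = 0); last first.
  by apply: (IHN (d i v)) => //; apply: stP.
have v_cst : v = c (e v) by apply/bounded1P.
have ev0 : e v != 0 by apply: contra_notN v0 => /eqP ev0; rewrite v_cst ev0 rmorph0.
by rewrite -(rmorph1 c) -(mulVf ev0) rmorphM /= -v_cst; exact: subspaceZ.
Qed.

Lemma cofactors1 : l <> c (e l) -> cofactors l 1.
Proof.
move=> l_ncst; have [/bounded1P//|/existsNP[i di0]] := EM (forall i, d i l = 0).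
exact: stable1 cofactors_subspace cofactors_stable (cofactors_cof i) di0.
Qed.

(** Every iterated cofactor of [l] has a last step, taken from [l] itself or from an element of
    [V_l]. In this form the fact feeds [nakayama]. *)
Lemma cofactors_image v : cofactors l v ->
  image_sum (fun i => d i) (fun g => exists k u, cofactors l u /\ g = c k * l + u) v.
Proof.
set G := fun g => _; have subG : subspace G.
  split=> [|k _ _ [k1 [u1 [lu1 ->]]] [k2 [u2 [lu2 ->]]]].
    by exists 0, 0; split; [exact: subspace0 subl|rewrite rmorph0 mul0r addr0].
  exists (k * k1 + k2), (c k * u1 + u2); split; first exact: subl.2.
  by rewrite mulrDr mulrA rmorphD rmorphM /= mulrDl addrACA.
have Gcof u : cofactors l u -> G u.
  by exists 0, u; split=> //; rewrite rmorph0 mul0r add0r.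
have d0 i : d i 0 = 0 by exact: raddf0.
apply=> [|i _ [h Gh ->]|i].
- by apply: image_sum_subspace => // i k a b; exact: cof_linear.
- apply: image_sum_gen => //; first exact: subspace0 subG.
  apply: Gcof; apply: subspace_sum => // j; have [k [u [lu ->]]] := Gh j.
  rewrite cof_linear; apply: subl.2; first exact: cofactors_cof.
  exact: cofactors_stable.
apply: image_sum_gen => //; first exact: subspace0 subG.
exists 1, 0; split; first exact: subspace0 subl.
by rewrite rmorph1 mul1r addr0.
Qed.

End Cofactors.

(* Some iterated cofactor of p * q + s is a nonzero multiple of q plus an      *)
(* element of the span of the proper cofactors of q, and such a sum generates  *)
(* q because taking cofactors is nilpotent.                                    *)
Lemma stable_product P p q s : subspace P -> cof_stable P -> p <> 0 ->
  cofactors q s -> P (p * q + s) -> P q /\ forall v, cofactors q v -> P v.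
Proof.
move=> subP stP + + Pw; have subq := cofactors_subspace q.
suff Pall k v : p <> 0 -> cofactors q s -> cofactors q v -> P (c k * q + v).
  move=> p0 qs; split=> [|v qv].
    rewrite -[q]addr0 -[q]mul1r -(rmorph1 c); apply: Pall => //.
    exact: subspace0 subq.
  by rewrite -[v]add0r -[0](mul0r q) -(rmorph0 c); apply: Pall.
have [N] := bounded_ex p.
elim: N p s Pw => [|N IHN] p s Pw Bp p0 qs qv //.
have [dp0|/existsNP[i di0]] := EM (forall i, d i p = 0); last first.
  apply: (IHN (d i p) (c (e p) * d i q + d i s)) => //.
    by rewrite addrA -cofM -raddfD; exact: stP.
  by apply: subq.2; [exact: cofactors_cof|exact: cofactors_stable].
have p_cst : p = c (e p) by apply/bounded1P.
have ep0 : e p != 0 by apply: contra_notN p0 => /eqP ep0; rewrite p_cst ep0 rmorph0.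
apply: (@nakayama P (fun g => exists k u, cofactors q u /\ g = c k * q + u)) => //;
  last by exists k, v.
- move=> _ [k' [u [qu ->]]]; pose r := k' / e p.
  exists (u - c r * s).
    by apply: cofactors_image; apply: (subspaceB subq) => //; exact: (subspaceZ subq).
  have -> : c k' * q + u - (u - c r * s) = c r * (p * q + s).
    rewrite opprB addrC [_ * q + u]addrC addrA subrK addrC mulrDr mulrA.
    by rewrite p_cst -rmorphM divfK.
  exact: subspaceZ.
have [M Bq] := bounded_ex q; exists M => _ [k' [u [qu ->]]].
apply: (bounded_subspace M).2 => //; apply: qu => //; first exact: bounded_subspace.
  exact: bounded_stable.
by move=> i; exact: bounded_stable.
Qed.

Lemma stable_mul P p q : subspace P -> cof_stable P -> p <> 0 ->
  P (p * q) -> P q /\ forall v, cofactors q v -> P v.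
Proof.
move=> subP stP p0 Ppq; apply: (@stable_product P p q 0) => //; last by rewrite addr0.
exact: subspace0 (cofactors_subspace q).
Qed.

(** The zero space [bounded 0] is stable, so [stable_mul] applies to it. *)
Lemma mul_eq0 p q : p <> 0 -> p * q = 0 -> q = 0.
Proof.
move=> p0 pq0; apply: (@stable_mul (bounded 0) p q _ _ p0 pq0).1.
  exact: bounded_subspace.
exact: bounded_stable.
Qed.

(** For [q] nonzero with least bound [N.+1], elements of [V_q] are bounded by [N]. If [t * q] with
    [t] nonzero were too, [stable_mul] for [bounded N] would give the same bound for [q], against
    minimality. *)
Lemma cofactors_ideal q v : cofactors q v -> ideal q v -> v = 0.
Proof.
move=> qv [t def_v]; have [t0|/eqP t0] := eqVneq t 0; first by rewrite def_v t0 mul0r.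
have exN : exists N, `[< bounded N q >].
  by have [N BN] := bounded_ex q; exists N; apply/asboolP.
have [[|N] /asboolP Bq minN] := ex_minnP exN.
  by rewrite def_v Bq mulr0.
have Bv : bounded N (t * q) by rewrite -def_v; exact: cofactors_bounded qv.
have [] := stable_mul (bounded_subspace N) (@bounded_stable N) t0 Bv.
by move=> /asboolP/minN; rewrite ltnn.
Qed.

Lemma mulIr_neq0 q a b : q <> 0 -> a * q = b * q -> a = b.
Proof.
move=> q0 abq; apply/subr0_eq; apply: contrapT => ab0; apply: q0.
by apply: (mul_eq0 ab0); rewrite mulrBl abq subrr.
Qed.

(** If some [d i p] is nonzero, then [d i (p * q)] is a nonzero multiple of [q] plus an element of
    [V_q], and [stable_product] applies. Otherwise [p] is a nonzero constant. *)
Lemma cofactors_mul_right p q v : p <> 0 -> cofactors q v -> cofactors (p * q) v.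
Proof.
move=> p0 qv; set P := cofactors (p * q).
have subP : subspace P by exact: cofactors_subspace.
have stP : cof_stable P by exact: cofactors_stable.
have Pd i : P (d i p * q + c (e p) * d i q) by rewrite -cofM; exact: cofactors_cof.
have subq := cofactors_subspace q.
have [dp0|/existsNP[i di0]] := EM (forall i, d i p = 0).
  have p_cst : p = c (e p) by apply/bounded1P.
  have ep0 : e p != 0.
    by apply: contra_notN p0 => /eqP ep0; rewrite p_cst ep0 rmorph0.
  apply: qv => // i; rewrite -[d i q]mul1r -(rmorph1 c) -(mulVf ep0) rmorphM -mulrA.
  by apply: (subspaceZ subP); have := Pd i; rewrite dp0 mul0r add0r.
have qd : cofactors q (c (e p) * d i q).
  by apply: (subspaceZ subq); exact: cofactors_cof.
exact: (stable_product subP stP di0 qd (Pd i)).2.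
Qed.

(** The product rule for [d i (b * q)] leaves a correction in [V_q], which lies in [V_(pq)] by
    [cofactors_mul_right]. *)
Lemma cofactors_mul_left p q a : p <> 0 -> cofactors p a -> cofactors (p * q) (a * q).
Proof.
move=> p0; have subP := cofactors_subspace (p * q).
have qP i k : cofactors (p * q) (c k * d i q).
  by apply: (subspaceZ subP); apply: cofactors_mul_right => //; exact: cofactors_cof.
move=> pa; apply: (pa (fun b => cofactors (p * q) (b * q))) => [|i b Pb|i].
- split=> [|k a' b Pa Pb]; first by rewrite mul0r; exact: subspace0 subP.
  by rewrite mulrDl -mulrA; exact: subP.2.
- rewrite -(addrK (c (e b) * d i q) (d i b * q)) -cofM.
  by apply: (subspaceB subP) => //; exact: cofactors_stable.
rewrite -(addrK (c (e p) * d i q) (d i p * q)) -cofM.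
by apply: (subspaceB subP) => //; exact: cofactors_cof.
Qed.

Lemma cofactors_mulP p q v : cofactors (p * q) v ->
  exists2 a, cofactors p a & cofactors q (v - a * q).
Proof.
have subp := cofactors_subspace p; have subq := cofactors_subspace q.
move=> pqv; apply: (pqv (fun u => exists2 a, cofactors p a & cofactors q (u - a * q))) =>
  [|i u [a pa qa]|i].
- split=> [|k u v' [a pa qa] [b pb qb]].
    by exists 0; [exact: subspace0 subp|rewrite mul0r subr0; exact: subspace0 subq].
  exists (c k * a + b); first exact: subp.2.
  by rewrite mulrDl -mulrA opprD addrACA -mulrBr; exact: subq.2.
- exists (d i a); first exact: cofactors_stable.
  rewrite -[u](subrK (a * q)) raddfD /= cofM addrA addrAC addrK.
  apply: (subspaceD subq); first exact: cofactors_stable.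
  by apply: (subspaceZ subq); exact: cofactors_cof.
exists (d i p); first exact: cofactors_cof.
rewrite cofM addrC addKr.
by apply: (subspaceZ subq); exact: cofactors_cof.
Qed.

Lemma cofactors_mul_inv p q a : q <> 0 -> cofactors (p * q) (a * q) -> cofactors p a.
Proof.
move=> q0 /cofactors_mulP[b pb]; rewrite -mulrBl => qab.
have /subr0_eq-> // : a - b = 0.
apply: contrapT => ab0; apply: q0; apply: (mul_eq0 ab0).
by apply: cofactors_ideal qab _; exact: idealM.
Qed.

(** * The action of the variables attached to [l] *)

Definition act l i a : A := d i a - c (e a / e l) * d i l.

Definition act_stable l P : Prop := forall i a, P a -> P (act l i a).

Lemma act_linear l i k a b : act l i (c k * a + b) = c k * act l i a + act l i b.
Proof.
rewrite /act cof_linear (rmorphD e) (rmorphM e) constant_scalar mulrDl.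
by rewrite (rmorphD c) -mulrA (rmorphM c) mulrDl -mulrA opprD addrACA -mulrBr.
Qed.

Lemma act0 l i : act l i 0 = 0.
Proof. by rewrite /act raddf0 rmorph0 mul0r rmorph0 mul0r subr0. Qed.

Lemma actD l i a b : act l i (a + b) = act l i a + act l i b.
Proof. by rewrite -[a]mul1r -(rmorph1 c) act_linear rmorph1 !mul1r. Qed.

Lemma actB l i a b : act l i (a - b) = act l i a - act l i b.
Proof. by rewrite addrC -mulN1r -(rmorphN1 c) act_linear rmorphN1 mulN1r addrC. Qed.

Lemma act_ideal l i t : e l != 0 -> act l i (t * l) = d i t * l.
Proof. by move=> l0; rewrite /act cofM (rmorphM e) mulfK // addrK. Qed.

Lemma act_mul p q i a : e p != 0 -> e q != 0 ->
  act (p * q) i (a * q) = act p i a * q.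
Proof.
move=> p0 q0; rewrite /act !cofM !(rmorphM e).
have -> : e a * e q / (e p * e q) = e a / e p by rewrite -mulf_div divff // mulr1.
rewrite mulrDr mulrA [c (e a / e p) * (_ * d i q)]mulrA -rmorphM divfK //.
by rewrite opprD addrACA subrr addr0 mulrBl.
Qed.

Lemma act_self l i : e l != 0 -> act l i l = 0.
Proof. by move=> l0; rewrite /act divff // rmorph1 mul1r subrr. Qed.

Lemma cofactors_act l : act_stable l (cofactors l).
Proof.
move=> i v lv; apply: (subspaceB (cofactors_subspace l)).
  exact: cofactors_stable.
by apply: (subspaceZ (cofactors_subspace l)); exact: cofactors_cof.
Qed.

Lemma ideal_act l i v : e l != 0 -> ideal l v -> ideal l (act l i v).
Proof. by move=> l0 [t ->]; rewrite act_ideal //; exact: idealM. Qed.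

Lemma cof_act1 l i : e l != 0 -> d i l = - (c (e l) * act l i 1).
Proof.
move=> l0; rewrite /act -(rmorph1 c) cof_scalar sub0r mulrN opprK constant_scalar.
by rewrite mulrA -rmorphM mulrCA divff // !mulr1 rmorph1 mul1r.
Qed.

Lemma act_cof l i a : d i a = act l i a + c (e a / e l) * d i l.
Proof. by rewrite subrK. Qed.

(** Modulo the left ideal of [l], this is the cofactor decomposition of [a] without its constant
    term: the action of [l] takes the place of the cofactor maps. *)
Lemma var_act l a : e l != 0 ->
  \sum_i x i * act l i a = a - c (e a / e l) * l.
Proof.
move=> l0; under eq_bigr do rewrite mulrBr mul_scalarCA.
have var_cof b : \sum_i x i * d i b = b - c (e b).
  by rewrite {2}[b]cof_decomposition addrC addKr.
rewrite sumrB -mulr_sumr !var_cof mulrBr -rmorphM divfK //.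
by rewrite opprB addrA subrK.
Qed.

(** With [l * a = t * g], comparing cofactors of both sides expresses [d i l * a], and comparing
    constant terms gives [e a / e g = e t / e l]. All terms then cancel except a left multiple of
    [g]. *)
Lemma act_right_mul l g a i u : e l != 0 -> e g != 0 ->
  ideal g (l * a) -> ideal g (act l i u * a - act g i (u * a)).
Proof.
move=> l0 g0 [t la].
have ela : e l * e a = e t * e g by rewrite -!rmorphM la.
have dla : d i l * a = d i t * g + c (e t) * d i g - c (e l) * d i a.
  by rewrite -cofM -la cofM addrK.
exists (- (c (e u / e l) * d i t)).
have eua : e (u * a) / e g = e u / e l * e t.
  rewrite (_ : e (u * a) = e u / e l * e t * e g) ?mulfK //.
  by rewrite -mulrA -ela mulrA divfK // rmorphM.
have canc (X Y Z W : A) : X - (Y + Z - W) - (X + W - Z) = - Y.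
  rewrite opprB [- (X + W - Z)]opprB [X + (W - _)]addrA [LHS]addrC addrA subrK.
  by rewrite opprD addrCA subrr addr0.
rewrite /act mulrBl -mulrA dla cofM eua mulrBr mulrDr !mulrA -!rmorphM divfK //.
by rewrite canc mulNr.
Qed.


(** * Units, submodules of [V_l] and irreducibility *)

Lemma cst_unit a k : k != 0 -> a = c k -> invertible a.
Proof.
by move=> k0 ->; exists (c k^-1); rewrite -!rmorphM divff // mulVf // rmorph1.
Qed.

(** The constants [bounded 1] form a stable subspace containing [b * a = 1], so [stable_mul] puts
    [a] in it. *)
Lemma invertible_cst a : invertible a -> a = c (e a) /\ e a != 0.
Proof.
case=> b [ab ba].
have ea : e a * e b = 1 by rewrite -rmorphM ab rmorph1.
have b0 : b <> 0 by move=> b0; move/eqP: ea; rewrite b0 rmorph0 mulr0 eq_sym oner_eq0.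
split; last by apply/eqP => ea0; move/eqP: ea; rewrite ea0 mul0r eq_sym oner_eq0.
apply/bounded1P; apply: (@stable_mul (bounded 1) b a _ _ b0 _).1.
- exact: bounded_subspace.
- exact: bounded_stable.
by rewrite ba => i; rewrite -(rmorph1 c); exact: cof_scalar.
Qed.

Lemma cofactors_non_unit a : a <> 0 -> ~ invertible a -> cofactors a 1.
Proof.
move=> a0 a_nunit; apply: cofactors1 => a_cst; apply: a_nunit.
apply: (cst_unit _ a_cst); apply: contra_notN a0 => /eqP ea0.
by rewrite a_cst ea0 rmorph0.
Qed.

Lemma constant_neq0 a : e a != 0 -> a <> 0.
Proof. by move=> ea0 a0; rewrite a0 rmorph0 eqxx in ea0. Qed.

(** The action of [x_i] on 1 is a nonzero multiple of [d i l], and a cofactor map differs from the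
    action by multiples of [d i l]. *)
Lemma cofactors_generated l W : e l != 0 -> subspace W -> act_stable l W -> W 1 ->
  forall v, cofactors l v -> W v.
Proof.
move=> l0 subW stW W1.
have Wd i : W (d i l).
  by rewrite cof_act1 //; apply: (subspaceN subW); apply: (subspaceZ subW); exact: stW.
move=> v lv; apply: lv => // i a Wa; rewrite (act_cof l).
by apply: (subspaceD subW); [exact: stW|exact: (subspaceZ subW)].
Qed.

(* W + K l is a left ideal, generated by an element of least degree among      *)
(* those with nonzero constant term.                                           *)
Lemma act_stable_ideal l W : e l != 0 -> subspace W -> act_stable l W ->
  exists r w k, [/\ W w, r = w + c k * l, ideal r l & forall v, W v -> ideal r v].
Proof.
move=> l0 subW stW; pose J v := exists k w, W w /\ v = w + c k * l.
have subJ : subspace J.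
  split=> [|k _ _ [k1 [w1 [W1 ->]]] [k2 [w2 [W2 ->]]]].
    by exists 0, 0; split; [exact: subspace0 subW|rewrite rmorph0 mul0r addr0].
  exists (k * k1 + k2), (c k * w1 + w2); split; first exact: subW.2.
  by rewrite mulrDr mulrA rmorphD rmorphM mulrDl addrACA.
have WJ v : W v -> J v by exists 0, v; rewrite rmorph0 mul0r addr0.
have Jl : J l.
  by exists 1, 0; split; [exact: subspace0 subW|rewrite rmorph1 mul1r add0r].
(* The action kills [l], so it maps [J = W + K l] into [W]. *)
have stJ i v : J v -> W (act l i v).
  move=> [k [w [Ww ->]]]; rewrite addrC act_linear act_self // mulr0 add0r.
  exact: stW.
have exN : exists N, `[< exists r, [/\ J r, e r != 0 & bounded N r] >].
  by have [N Bl] := bounded_ex l; exists N; apply/asboolP; exists l.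
have [N /asboolP[r [Jr r0 Br]] minN] := ex_minnP exN.
have Jideal v : J v -> ideal r v.
  have [M] := bounded_ex v; elim: M v => [|M IHM] v Bv Jv.
    by rewrite Bv; exact: subspace0 (ideal_subspace r).
  pose k := e v / e r; pose u := v - c k * r.
  have Ju : J u by apply: (subspaceB subJ) => //; exact: (subspaceZ subJ).
  (* If [e v] is nonzero, minimality of [N] bounds [r] by [M.+1], so subtracting a multiple of [r]
     does not raise the bound. *)
  have Bu : bounded M.+1 u.
    have [ev0|ev0] := eqVneq (e v) 0.
      by rewrite /u /k ev0 mul0r rmorph0 mul0r subr0.
    have subB := bounded_subspace M.+1.
    apply: (subspaceB subB) => //; apply: (subspaceZ subB); apply: bounded_le Br.
    by apply: minN; apply/asboolP; exists v.
  have eu : e u = 0 by rewrite rmorphB (rmorphM e) constant_scalar divfK // subrr.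
  have subI := ideal_subspace r.
  rewrite -(subrK (c k * r) v); apply: (subspaceD subI); last exact: idealM.
  (* As [u] has no constant term, it is the sum of the [x i * d i u], and [d i u = act l i u] lies
     in [W]; induction applies to it. *)
  rewrite -/u (cof_decomposition u) eu rmorph0 add0r.
  apply: (subspace_sum subI) => i; apply: ideal_mull; apply: IHM; first exact: Bu.
  apply: WJ; have := stJ i u Ju.
  by rewrite /act eu mul0r rmorph0 mul0r subr0.
have [k [w [Ww def_r]]] := Jr.
by exists r, w, k; split=> // [|v /WJ]; exact: Jideal.
Qed.

(** Write [l = p * r] with [r = w + c k * l] from [act_stable_ideal]. If [r] is a unit and [k = 0],
    then 1 is in [W], which is all of [V_l]; if [k] is nonzero, [l] would lie in [V_l], against
    [cofactors_ideal]. If [p] is a unit, [W] lies in both [V_l] and [A l], hence is 0. *)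
Lemma irreducible_no_act_stable l W : e l != 0 -> irreducible l ->
  subspace W -> act_stable l W -> (forall w, W w -> cofactors l w) ->
  (forall w, W w -> w = 0) \/ (forall v, cofactors l v -> W v).
Proof.
move=> l0 [[l_neq0 l_nunit] l_irr] subW stW Wl.
have [r [w [k [Ww def_r [p def_l] Wr]]]] := act_stable_ideal l0 subW stW.
have [r_unit|r_nunit] := EM (invertible r).
  right; have [r_cst er0] := invertible_cst r_unit.
  have W1_r : W r -> W 1.
    move=> Wr1; rewrite -(rmorph1 c) -(mulVf er0) rmorphM -r_cst.
    exact: (subspaceZ subW).
  have [k0|k0] := eqVneq k 0.
    apply: cofactors_generated => //; apply: W1_r.
    by rewrite def_r k0 rmorph0 mul0r addr0.
  case: (l_neq0); apply: (@cofactors_ideal l); last by exists 1; rewrite mul1r.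
  have subl := cofactors_subspace l.
  suff: cofactors l (c k^-1 * (r - w)).
    by rewrite def_r addrC addKr mulrA -rmorphM mulVf // rmorph1 mul1r.
  apply: (subspaceZ subl); apply: (subspaceB subl); last exact: Wl.
  rewrite r_cst -[c (e r)]mulr1; apply: (subspaceZ subl).
  exact: cofactors_non_unit.
have [p_unit|p_nunit] := EM (invertible p).
  left=> v Wv; apply: (@cofactors_ideal l); first exact: Wl.
  have [q [pq qp]] := p_unit; have [t ->] := Wr v Wv.
  by exists (t * q); rewrite def_l mulrA -(mulrA t) qp mulr1.
case: l_irr; exists p, r; split=> //; split=> // z0.
  by case: l_neq0; rewrite def_l z0 mul0r.
by case: l_neq0; rewrite def_l z0 mulr0.
Qed.

(** A factorization [l = p * q] into non-units yields the submodule [V_p q]. It contains [q], so it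
    is nonzero; it misses 1, which lies in [V_q] and hence not in the left ideal of [q]. *)
Lemma no_act_stable_irreducible l : e l != 0 ->
  (exists2 v, cofactors l v & v <> 0) ->
  (forall W, subspace W -> act_stable l W -> (forall w, W w -> cofactors l w) ->
    (forall w, W w -> w = 0) \/ (forall v, cofactors l v -> W v)) ->
  irreducible l.
Proof.
move=> l0 [v lv v0] simple_l; split.
  split=> [|/invertible_cst[l_cst _]]; first exact: constant_neq0.
  by apply: v0; exact: cofactors_cst lv.
move=> [p [q [[p0 p_nunit] [q0 q_nunit] def_l]]].
move: (l0); rewrite def_l rmorphM mulf_eq0 negb_or => /andP[ep0 eq0].
have q1 := cofactors_non_unit q0 q_nunit; have p1 := cofactors_non_unit p0 p_nunit.
pose W w := exists2 a, cofactors p a & w = a * q.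
have subp := cofactors_subspace p.
have [|||Wz|lW] := simple_l W.
- split=> [|k _ _ [a pa ->] [b pb ->]].
    by exists 0; [exact: subspace0 subp|rewrite mul0r].
  by exists (c k * a + b); [exact: subp.2|rewrite mulrDl mulrA].
- move=> i _ [a pa ->]; exists (act p i a); first exact: cofactors_act.
  by rewrite def_l act_mul.
- by move=> _ [a pa ->]; rewrite def_l; exact: cofactors_mul_left.
- by apply: q0; apply: Wz; exists 1; rewrite ?mul1r.
have [|a _ one_aq] := lW 1; first by rewrite def_l; exact: cofactors_mul_right.
have /eqP : (1 : A) = 0 by apply: cofactors_ideal q1 _; exists a.
by rewrite oner_eq0.
Qed.


(** * The subquotient of [V_l] attached to a factor of [l] *)

Definition pair_subspace (Q : A -> A -> Prop) : Prop :=
  Q 0 0 /\ forall k v w v' w', Q v w -> Q v' w' ->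
    Q (c k * v + v') (c k * w + w').

Lemma pair_subspaceD Q v w v' w' : pair_subspace Q ->
  Q v w -> Q v' w' -> Q (v + v') (w + w').
Proof.
move=> [_ Qlin] vw v'w'; rewrite -[v]mul1r -[w]mul1r -(rmorph1 c).
exact: Qlin.
Qed.

Lemma pair_subspaceZ Q k v w : pair_subspace Q -> Q v w -> Q (c k * v) (c k * w).
Proof.
by move=> [Q0 Qlin] vw; rewrite -[c k * v]addr0 -[c k * w]addr0; exact: Qlin.
Qed.

Section FactorRelation.
Variables (l p q r : A).
Hypotheses (l0 : e l != 0) (def_l : l = p * q * r).

(** For [l = p q r] this induces the isomorphism from the elements of [V_l] in [A r], modulo those
    in [A q r], onto [V_q]. *)
Definition factor_relation v u : Prop := ideal (q * r) (v - u * r).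

Let nz : [/\ e p != 0, e q != 0 & e r != 0].
Proof. by move: l0; rewrite def_l !(rmorphM e) !mulf_eq0 !negb_or => /andP[/andP[]]. Qed.

Lemma factor_relation_linear k v u v' u' :
  factor_relation v u -> factor_relation v' u' ->
  factor_relation (c k * v + v') (c k * u + u').
Proof.
move=> vu vu'; rewrite /factor_relation mulrDl -mulrA opprD addrACA -mulrBr.
exact: (ideal_subspace _).2.
Qed.

Lemma factor_relation_subspace : pair_subspace factor_relation.
Proof.
split=> [|k v u v' u']; last exact: factor_relation_linear.
by rewrite /factor_relation mul0r subrr; exact: (ideal_subspace _).1.
Qed.

Lemma factor_relation_act i v u : factor_relation v u ->
  factor_relation (act l i v) (act q i u).
Proof.
have [p0 q0 r0] := nz; case=> t; rewrite mulrA => def_v.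
have {def_v} -> : v = (u + t * q) * r by rewrite mulrDl -def_v addrC subrK.
rewrite /factor_relation def_l act_mul ?(rmorphM e) ?mulf_neq0 // -mulrBl.
set y := u + t * q.
suff [s hs] : ideal q (act (p * q) i y - act q i u).
  by exists s; rewrite hs mulrA.
have -> : act q i u = act q i y - d i t * q.
  by rewrite /y actD act_ideal // addrK.
rewrite opprB addrCA; apply: (subspaceD (ideal_subspace q)); first exact: idealM.
(* Taking 1 as the multiplier in [act_right_mul]: since [p * q] is a left multiple of [q], the two
   actions agree modulo the left ideal of [q]. *)
rewrite -[act (p * q) i y]mulr1 -{2}[y]mulr1.
apply: act_right_mul; rewrite ?(rmorphM e) ?mulf_neq0 // mulr1.
exact: idealM.
Qed.

Lemma factor_relation_left v : cofactors l v -> ideal r v ->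
  exists2 u, cofactors q u & factor_relation v u.
Proof.
move=> + [a def_v]; have [_ _ r0] := nz.
rewrite def_v def_l => /(cofactors_mul_inv (constant_neq0 r0)) /cofactors_mulP.
case=> b _ qu; exists (a - b * q) => //; exists b.
by rewrite -mulrBl opprB addrCA subrr addr0 mulrA.
Qed.

Lemma factor_relation_right u : cofactors q u ->
  exists2 v, cofactors l v /\ ideal r v & factor_relation v u.
Proof.
move=> qu; have [p0 q0 r0] := nz; exists (u * r).
  split; last exact: idealM.
  rewrite def_l; apply: cofactors_mul_left.
    by apply: constant_neq0; rewrite (rmorphM e) mulf_neq0.
  by apply: cofactors_mul_right => //; exact: constant_neq0.
by rewrite /factor_relation subrr; exact: subspace0 (ideal_subspace _).
Qed.

Lemma factor_relation_eq0 v u : cofactors q u -> factor_relation v u ->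
  (ideal (q * r) v <-> u = 0).
Proof.
move=> qu vu; have [p0 q0 r0] := nz; have subI := ideal_subspace (q * r).
split=> [Iv|u0]; last by move: vu; rewrite /factor_relation u0 mul0r subr0.
apply: (cofactors_ideal qu).
have [t] : ideal (q * r) (u * r) by rewrite -(subKr v (u * r)); exact: subspaceB.
by rewrite mulrA => /(mulIr_neq0 (constant_neq0 r0)) ->; exact: idealM.
Qed.

End FactorRelation.

(** * Similarity pairs and the isomorphisms they induce *)

(** Right multiplications by [a] and [b] give mutually inverse maps between [A/Al] and [A/Ag]. *)
Definition similarity_pair l g a b : Prop :=
  [/\ ideal g (l * a), ideal l (g * b), ideal l (a * b - 1) & ideal g (b * a - 1)].

Lemma similarity_pair_sym l g a b :
  similarity_pair l g a b -> similarity_pair g l b a.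
Proof. by case. Qed.

Definition mul_relation g a u w : Prop := ideal g (u * a - w).

Lemma mul_relation_linear g a k u w u' w' :
  mul_relation g a u w -> mul_relation g a u' w' ->
  mul_relation g a (c k * u + u') (c k * w + w').
Proof.
move=> uw uw'; rewrite /mul_relation mulrDl -mulrA opprD addrACA -mulrBr.
exact: (ideal_subspace _).2.
Qed.

Lemma mul_relation_subspace g a : pair_subspace (mul_relation g a).
Proof.
split=> [|k v u v' u']; last exact: mul_relation_linear.
by rewrite /mul_relation mul0r subrr; exact: (ideal_subspace _).1.
Qed.

Section Pair.
Variables (l g a b : A).
Hypotheses (l0 : e l != 0) (g0 : e g != 0) (ab : similarity_pair l g a b).

Lemma ideal_pair u : ideal g (u * a) -> ideal l u.
Proof.
case: ab => _ glb ab1 _ [t def_ua]; have subI := ideal_subspace l.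
have -> : u = u * a * b - u * (a * b - 1).
  by rewrite mulrBr mulr1 mulrA opprB addrCA subrr addr0.
apply: (subspaceB subI); last exact: ideal_mull.
by rewrite def_ua -mulrA; exact: ideal_mull.
Qed.

Lemma ideal_mul_pair u : ideal l u -> ideal g (u * a).
Proof. by case: ab => lag _ _ _ [t ->]; rewrite -mulrA; exact: ideal_mull. Qed.

Lemma mul_relation_sym u w : mul_relation l b w u -> mul_relation g a u w.
Proof.
rewrite /mul_relation => wu; have [_ _ _ ba1] := ab; have subI := ideal_subspace g.
have -> : u * a - w = w * (b * a - 1) - (w * b - u) * a.
  by rewrite mulrBr mulr1 mulrBl mulrA opprB [RHS]addrC addrA subrK.
apply: (subspaceB subI); first exact: ideal_mull.
exact: ideal_mul_pair.
Qed.

Lemma mul_relation_act i u w : mul_relation g a u w ->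
  mul_relation g a (act l i u) (act g i w).
Proof.
rewrite /mul_relation => uw; have [lag _ _ _] := ab; have subI := ideal_subspace g.
rewrite -(subrK (act g i (u * a)) (act l i u * a)) -addrA -actB.
apply: (subspaceD subI); first exact: act_right_mul.
exact: ideal_act.
Qed.

Lemma mul_relation_eq0 u w : cofactors l u -> cofactors g w ->
  mul_relation g a u w -> (u = 0 <-> w = 0).
Proof.
move=> lu gw uw; split=> z0; rewrite /mul_relation z0 ?mul0r ?sub0r ?subr0 in uw.
  apply: (cofactors_ideal gw); rewrite -[w]opprK.
  exact: (subspaceN (ideal_subspace g)).
by apply: (cofactors_ideal lu); exact: ideal_pair.
Qed.

(** When [l] is not constant, 1 is in [V_l], so each [d i l] is a value of the action on [V_l]; the
    other cofactors are such values plus multiples of the [d i l]. *)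
Lemma cofactors_act_image v : cofactors l v ->
  image_sum (fun i => act l i) (cofactors l) v.
Proof.
move=> lv; have subl := cofactors_subspace l.
have [l_cst|l_ncst] := EM (l = c (e l)).
  exists (fun=> 0) => [i|]; first exact: subspace0 subl.
  by rewrite (cofactors_cst l_cst lv) big1 // => i _; exact: act0.
have genG i u : cofactors l u -> image_sum (fun i => act l i) (cofactors l) (act l i u).
  by move=> lu; apply: image_sum_gen => //; [exact: act0|exact: subspace0 subl].
have subI : subspace (image_sum (fun i => act l i) (cofactors l)).
  by apply: image_sum_subspace => // i k u w; exact: act_linear.
have Id i : image_sum (fun i => act l i) (cofactors l) (d i l).
  rewrite cof_act1 //; apply: (subspaceN subI); apply: (subspaceZ subI); apply: genG.
  exact: cofactors1.
pose P u := cofactors l u /\ image_sum (fun i => act l i) (cofactors l) u.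
suff [] : P v by [].
apply: lv => [|i u [lu _]|i]; last by split=> //; exact: cofactors_cof.
- split=> [|k u w [lu Iu] [lw Iw]]; first by split; exact: subspace0.
  by split; [exact: subl.2|exact: subI.2].
split; first exact: cofactors_stable.
by rewrite (act_cof l); apply: (subspaceD subI); [exact: genG|exact: subspaceZ].
Qed.

(** The space [V_g + A g] is stable under cofactors. Writing [u] as a sum of [act l i (h i)], right
    multiplication by [a] gives [act g i (h i * a)] modulo [A g], which is [d i (h i * a)] modulo
    [V_g]. This is the hypothesis of [nakayama] for [V_l a]. *)
Lemma mul_relation_total u : cofactors l u ->
  exists2 w, cofactors g w & mul_relation g a u w.
Proof.
have subg := cofactors_subspace g; have subI := ideal_subspace g.
have [lag _ _ _] := ab.
pose P v := exists2 w, cofactors g w & ideal g (v - w).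
have subP : subspace P.
  split=> [|k v1 v2 [w1 gw1 vw1] [w2 gw2 vw2]].
    by exists 0; [exact: subspace0 subg|rewrite subr0; exact: subspace0 subI].
  exists (c k * w1 + w2); first exact: subg.2.
  by rewrite opprD addrACA -mulrBr; exact: subI.2.
have gP w : cofactors g w -> P w.
  by exists w => //; rewrite subrr; exact: subspace0 subI.
have IP v : ideal g v -> P v.
  by exists 0; [exact: subspace0 subg|rewrite subr0].
have stP : cof_stable P.
  move=> i v [w gw [t def_v]]; rewrite -(subrK w v) def_v raddfD /= cofM -addrA.
  apply: (subspaceD subP); first by apply: IP; exact: idealM.
  apply: gP; apply: subg.2; first exact: cofactors_cof.
  exact: cofactors_stable.
move=> lu; suff : P (u * a) by [].
apply: (@nakayama P (fun v => exists2 u, cofactors l u & v = u * a)) => //;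
  last by exists u.
  move=> _ [u' lu' ->]; have [h lh ->] := cofactors_act_image lu'.
  exists (\sum_i d i (h i * a)).
    by exists (fun i => h i * a) => // i; exists (h i).
  rewrite mulr_suml -sumrB; apply: (subspace_sum subP) => i.
  rewrite -(subrK (act g i (h i * a)) (act l i (h i) * a)) -addrA.
  apply: (subspaceD subP); first by apply: IP; exact: act_right_mul.
  rewrite {1}/act addrAC subrr add0r; apply: gP.
  by apply: (subspaceN subg); apply: (subspaceZ subg); exact: cofactors_cof.
have [N Bl] := bounded_ex l; have [M Ba] := bounded_ex a.
exists (N + M)%N => _ [u' lu' ->]; apply: boundedM => //.
by apply: cofactors_bounded lu'; exact: boundedS.
Qed.

End Pair.

(** * From module isomorphisms to similarity pairs *)

Definition act_relation l g (Q : A -> A -> Prop) : Prop :=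
  [/\ forall v w, Q v w -> cofactors l v /\ cofactors g w,
      forall k v w v' w', Q v w -> Q v' w' -> Q (c k * v + v') (c k * w + w'),
      forall v w, Q v w -> (v = 0 <-> w = 0) &
      forall i v w, Q v w -> Q (act l i v) (act g i w)].

(** Induction on the bound of [v]. Once the constant term of [v] is removed, with the same multiple
    of [a] removed from [w], the action on [v'] is the plain cofactor; the congruences for the
    [d i v] are reassembled by [var_act]. *)
Lemma act_relation_mul l g Q a v w : e l != 0 -> e g != 0 ->
  act_relation l g Q -> Q 1 a -> Q v w -> ideal g (v * a - w).
Proof.
move=> l0 g0 [Qlg Qlin Q0 Qact] Q1.
have [N] := bounded_ex v; elim: N v w => [|N IHN] v w Bv Qvw.
  rewrite Bv mul0r sub0r ((Q0 _ _ Qvw).1 Bv) oppr0.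
  exact: subspace0 (ideal_subspace g).
pose k := e v; pose v' := v - c k; pose w' := w - c k * a.
have Qv'w' : Q v' w'.
  by have := Qlin (- k) _ _ _ _ Q1 Qvw; rewrite rmorphN !mulNr mulr1 addrC [_ + w]addrC.
have subI := ideal_subspace g.
have IH i : ideal g (d i v * a - act g i w').
  apply: IHN; first exact: Bv.
  have := Qact i _ _ Qv'w'; rewrite {1}/act rmorphB constant_scalar subrr mul0r rmorph0.
  by rewrite mul0r subr0 raddfB /= cof_scalar subr0.
have -> : v * a - w = \sum_i x i * (d i v * a - act g i w') - c (e w' / e g) * g.
  under eq_bigr do rewrite mulrBr mulrA.
  rewrite sumrB var_act // -mulr_suml.
  have -> : \sum_i x i * d i v = v - c k by rewrite {2}[v]cof_decomposition addrC addKr.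
  by rewrite opprB [_ - w']addrC addrA addrK mulrBl opprB addrA subrK.
apply: (subspaceB subI); last exact: idealM.
by apply: (subspace_sum subI) => i; exact: ideal_mull.
Qed.

(** Since [d i l] is [- e l] times the action on 1, [act_relation_mul] gives [d i l * a] modulo
    [A g]. Summing over the variables with [var_act] turns [l * a] into an element of [A g]. *)
Lemma act_relation_ideal l g Q a : e l != 0 -> e g != 0 ->
  act_relation l g Q -> Q 1 a -> ideal g (l * a).
Proof.
move=> l0 g0 lgQ Q1; have [Qlg Qlin Q0 Qact] := lgQ; have subI := ideal_subspace g.
have dla i : ideal g (d i l * a + c (e l) * act g i a).
  rewrite cof_act1 // mulNr -mulrA addrC -mulrBr; apply: (subspaceZ subI).
  rewrite -opprB; apply: (subspaceN subI).
  by apply: (act_relation_mul l0 g0 lgQ Q1); exact: Qact.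
have -> : l * a = \sum_i x i * (d i l * a + c (e l) * act g i a) +
    c (e l * (e a / e g)) * g.
  under eq_bigr do rewrite mulrDr mulrA mul_scalarCA.
  rewrite big_split -mulr_suml -mulr_sumr var_act //=.
  rewrite mulrBr [c _ * (c _ * g)]mulrA -(rmorphM c) addrA subrK -mulrDl.
  by rewrite {1}[l]cof_decomposition addrC.
apply: (subspaceD subI); last exact: idealM.
by apply: (subspace_sum subI) => i; exact: ideal_mull.
Qed.

Lemma act_relation_sym l g Q :
  act_relation l g Q -> act_relation g l (fun w v => Q v w).
Proof.
case=> Qlg Qlin Q0 Qact; split.
- by move=> v w /Qlg[].
- by move=> k v w v' w'; exact: Qlin.
- by move=> v w /Q0[].
by move=> i v w; exact: Qact.
Qed.

Lemma act_relation_pair l g Q a b : e l != 0 -> e g != 0 ->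
  act_relation l g Q -> Q 1 a -> Q b 1 -> similarity_pair l g a b.
Proof.
move=> l0 g0 lgQ Q1a Qb1; have glQ := act_relation_sym lgQ; split.
- exact: act_relation_ideal lgQ Q1a.
- exact: act_relation_ideal glQ Qb1.
- exact: act_relation_mul glQ Qb1 Q1a.
exact: act_relation_mul lgQ Q1a Qb1.
Qed.


Definition residue q : A -> cyclic_module q :=
  @quotient_pi A A^o (@left_multiples A q).

Lemma residue_eq q u v : residue q u = residue q v <-> ideal q (u - v).
Proof.
by split=> [/eqP|/asboolP uv]; [|apply/eqP]; rewrite quotient_piP // => /asboolP.
Qed.

Lemma residue_linear q t u v : t *: residue q u + residue q v = residue q (t * u + v).
Proof. by rewrite -[t *: _]quotient_piZ -quotient_piD. Qed.

Lemma residue0 q : residue q 0 = 0.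
Proof.
by have := residue_linear q (-1) 0 0; rewrite scaleN1r addNr mulr0 addr0 => <-.
Qed.

Lemma residue_eq0 q u : residue q u = 0 <-> ideal q u.
Proof. by rewrite -(residue0 q) residue_eq subr0. Qed.

Lemma residueM q u v : residue q (u * v) = u *: residue q v.
Proof. by rewrite -[RHS]addr0 -(residue0 q) residue_linear addr0. Qed.

Lemma residueP q (z : cyclic_module q) : exists u, z = residue q u.
Proof. by exists (repr (z : Quotient.quot _)); rewrite /residue quotient_piW. Qed.

(** Here [b] represents the image of 1 and [a] its preimage; a map of cyclic modules is right
    multiplication by the image of 1. *)
Lemma cyclic_iso_pair l g :
  mod_iso (cyclic_module g) (cyclic_module l) <-> exists a b, similarity_pair l g a b.
Proof.
split=> [[f [h fK hK]]|[a [b gl]]].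
  have [b fb] := residueP (f (residue g 1)); have [a ha] := residueP (h (residue l 1)).
  have fE u : f (residue g u) = residue l (u * b).
    by rewrite -{1}[u]mulr1 residueM linearZ /= fb -residueM.
  have ab1 : residue l (a * b) = residue l 1 by rewrite -fE -ha hK.
  have faE u : f (residue g (u * a)) = residue l u.
    by rewrite fE -mulrA residueM ab1 -residueM mulr1.
  exists a, b; split.
  - apply/residue_eq0; apply: (can_inj fK); rewrite faE linear0; apply/residue_eq0.
    by exists 1; rewrite mul1r.
  - apply/residue_eq0; rewrite -fE (residue_eq0 g g).2 ?linear0 //.
    by exists 1; rewrite mul1r.
  - exact/residue_eq.
  by apply/residue_eq; apply: (can_inj fK); rewrite faE fb.
have [lag gbl ab1 ba1] := gl; have subI := ideal_subspace l.
pose Q X Y := exists u v, [/\ X = residue g u, Y = residue l v & mul_relation l b u v].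
apply: (@mod_iso_rel _ _ _ Q).
- move=> t _ _ _ _ [u [v [-> -> uv]]] [u' [v' [-> -> uv']]].
  exists (t * u + u'), (t * v + v'); rewrite -!residue_linear; split=> //.
  rewrite /mul_relation mulrDl opprD addrACA -mulrA -mulrBr.
  by apply: (subspaceD subI) => //; exact: ideal_mull.
- move=> X; have [u ->] := residueP X; exists (residue l (u * b)), u, (u * b).
  by split=> //; rewrite /mul_relation subrr; exact: subspace0 subI.
- move=> Y; have [v ->] := residueP Y; exists (residue g (v * a)), (v * a), v.
  split=> //; rewrite /mul_relation -mulrA -{2}[v]mulr1 -mulrBr.
  exact: ideal_mull.
move=> _ _ [u [v [-> -> uv]]]; rewrite !residue_eq0; split=> [[t gu]|lv].
  rewrite -(subKr (u * b) v); apply: (subspaceB subI) => //.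
  by rewrite gu -mulrA; exact: ideal_mull.
apply: (ideal_pair (similarity_pair_sym gl)).
by rewrite -(subrK v (u * b)); exact: subspaceD.
Qed.

End CofactorCalculus.

Lemma decomposition_mul (R : nzRingType) (I : finType) (k h p q : R)
    (x f g : I -> R) : (forall a, a * k = k * a) ->
  p = k + \sum_i x i * f i -> q = h + \sum_i x i * g i ->
  p * q = k * h + \sum_i x i * (f i * q + k * g i).
Proof.
move=> kC def_p def_q.
under eq_bigr do rewrite mulrDr mulrA [x _ * (k * _)]mulrA kC -[k * _ * _]mulrA.
rewrite big_split /= -mulr_sumr -mulr_suml addrCA -mulrDr -def_q.
by rewrite {1}def_p mulrDl addrC.
Qed.

Lemma prod_suffix (R : nzRingType) (m : nat) (f : 'I_m -> R) :
  exists a r : nat -> R, [/\ r 0%N = \prod_i f i, r m = 1,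
    forall i : 'I_m, r i = f i * r i.+1 & forall j, \prod_i f i = a j * r j].
Proof.
pose g k := oapp f 1 (insub k).
have gE (i : 'I_m) : g i = f i by rewrite /g valK.
have prodE : \prod_i f i = \prod_(0 <= k < m) g k.
  by rewrite big_mkord; apply: eq_bigr => i _; rewrite gE.
(* Capping the prefix at [m] makes the splitting hold for every natural [j]. *)
exists (fun j => \prod_(0 <= k < minn j m) g k).
exists (fun j => \prod_(j <= k < m) g k); split=> [|||j].
- by rewrite prodE.
- by rewrite big_geq.
- by move=> i; rewrite big_ltn // gE.
rewrite prodE; case: (leqP j m) => [jm|/ltnW mj]; first by rewrite -big_cat_nat.
by rewrite (@big_geq _ _ _ j) // mulr1.
Qed.

(** * The free algebra as a cofactor ring, and its modules [V_lam] *)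

Section FreeAlgebraCofactors.
Variables (K : fieldType) (n : nat).
Local Notation Lambda := {freealg K[n]}.
Local Notation cofactor := (@Defs.cofactor K n).

Fact cofactor_is_additive (i : 'I_n) : additive (cofactor i).
Proof.
move=> p q; apply/malgP => w.
by rewrite mcoeff_cofactor !mcoeffB; congr (_ - _); exact/esym/mcoeff_cofactor.
Qed.

HB.instance Definition _ (i : 'I_n) :=
  GRing.isAdditive.Build Lambda Lambda (cofactor i) (cofactor_is_additive i).

Definition const_term_morphism : {rmorphism Lambda -> K} :=
  @mcoeff {fmonom 'I_n} K mone.
Definition scalar_morphism : {rmorphism K -> Lambda} :=
  @mkmalgU {fmonom 'I_n} K mone.
Definition cofactor_morphism (i : 'I_n) : {additive Lambda -> Lambda} := cofactor i.

Fact malgC_central (k : K) (p : Lambda) : p * scalar_morphism k = scalar_morphism k * p.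
Proof.
rewrite /scalar_morphism /= mul_malgC malgM_def malgZ_def fgmulgU.
by apply: eq_bigr => w _; rewrite mulm1 mulrC.
Qed.

Fact cofactor_malgC (i : 'I_n) (k : K) : cofactor i k%:MP = 0.
Proof.
apply/malgP => w; rewrite mcoeff_cofactor mcoeffC mcoeff0.
by rewrite (fmoneE 'I_n : mone = _) fmP.
Qed.

Fact cofactor_mul (i : 'I_n) (p q : Lambda) :
  cofactor i (p * q) = cofactor i p * q + (const_term p)%:MP * cofactor i q.
Proof.
have def_pq := decomposition_mul (malgC_central (const_term p))
  (cofactor_decomposition p) (cofactor_decomposition q).
have cM : (const_term p)%:MP * (const_term q)%:MP =
    (const_term p * const_term q)%:MP :> Lambda.
  exact: (esym (rmorphM scalar_morphism _ _)).
exact: (esym ((cofactor_unique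
  (etrans def_pq (congr1 (fun a => a + _) cM))).2 i)).
Qed.

Fact iter_cofactor_nilpotent (p : Lambda) : exists N, forall w : seq 'I_n,
  (N <= size w)%N -> foldl (fun b i => cofactor i b) p w = 0.
Proof.
have coefE w v : (foldl (fun b i => cofactor i b) p w)@_(FMonom v) = p@_(FMonom (w ++ v)).
  elim: w p => [|i w IHw] //= q.
  by rewrite IHw mcoeff_cofactor.
exists (mmeasure (@fdeg 'I_n) p) => w wN; apply/malgP => -[v].
rewrite coefE mcoeff0; apply: mcoeff_outdom; apply: mmeasure_mnm_ge.
by apply: (leq_trans wN); change (size w <= size (w ++ v))%N; rewrite size_cat leq_addr.
Qed.


Definition freealg_cofactorRing : cofactorRing K 'I_n :=
  @CofactorRing K 'I_n Lambda scalar_morphism const_term_morphism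
    (@freealg_var K n) cofactor_morphism malgC_central
    (fun k => malgCK k) cofactor_malgC cofactor_mul
    (@cofactor_decomposition K n) iter_cofactor_nilpotent.

Local Notation L := freealg_cofactorRing.
Local Notation cofactors := (@cofactors K 'I_n L).
Local Notation act := (@act K 'I_n L).

Lemma scalarE (k : K) (a : Lambda) : k *: a = (scalar L k : Lambda) * a.
Proof. exact: esym (mul_malgC k a). Qed.

Lemma cofactor_span_subspace (lam : Lambda) :
  @subspace K 'I_n L (fun v : Lambda => (v : star_module lam) \in @cofactor_span K n lam).
Proof.
split=> [|k a b aV bV]; first exact: cofactor_span0.
rewrite -(scalarE k a); apply: cofactor_spanD => //; exact: cofactor_spanZ.
Qed.

(** The span is stable under plain cofactors because these differ from the action by multiples of
    the first cofactors of [lam]. *)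
Lemma cofactor_spanE (lam v : Lambda) :
  (v : star_module lam) \in @cofactor_span K n lam <-> cofactors lam v.
Proof.
split=> [/cofactor_spanP[r [r1 ->]]|lv].
  have sub := @cofactors_subspace K 'I_n L lam.
  have iterP (b : seq 'I_n) p : cofactors lam p ->
      cofactors lam (foldl (fun q i => cofactor i q) p b).
    elim: b p => //= i b IHb p lp; apply: IHb.
    exact: (@cofactors_stable K 'I_n L lam i p lp).
  elim: r r1 => [_|[k b] r IHr /= /andP[b1 r1]].
    by rewrite big_nil; exact: subspace0 sub.
  rewrite big_cons scalarE; apply: sub.2; last exact: IHr.
  case: b b1 => -[|i b] //= _.
  exact: (iterP b (cofactor i lam) (@cofactors_cof K 'I_n L lam i)).
apply: (lv (fun v : Lambda => (v : star_module lam) \in @cofactor_span K n lam)).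
  exact: cofactor_span_subspace.
  move=> i a aV.
  have -> : cof L i a = star lam i a +
      (const_term a * (const_term lam)^-1) *: cofactor i lam.
    by rewrite /star scaleNr addrC addNKr.
  apply: cofactor_spanD; first exact: star_span.
  apply: cofactor_spanZ; exact: (@iter_cofactor_span K n lam (FMonom [:: i])).
by move=> i; exact: (@iter_cofactor_span K n lam (FMonom [:: i])).
Qed.

Lemma star_act (lam : Lambda) (i : 'I_n) (a : Lambda) : star lam i a = act lam i a.
Proof. by rewrite /star scaleNr scalarE addrC. Qed.

Lemma star_action_relation (lam gam : Lambda) (Q : Lambda -> Lambda -> Prop) :
  @pair_subspace K 'I_n L Q ->
  (forall i v w, Q v w -> Q (act lam i v) (act gam i w)) ->
  forall p v w : Lambda, Q v w -> Q (star_action lam p v) (star_action gam p w).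
Proof.
move=> subQ Qact p v w Qvw.
have Qmono (m : seq 'I_n) : Q (foldr (star lam) v m) (foldr (star gam) w m).
  by elim: m => //= i m IHm; rewrite !star_act; exact: Qact.
have Qterm (m : {fmonom 'I_n}) :
    Q (p@_m *: star_monomial lam m v) (p@_m *: star_monomial gam m w).
  have Qeq a a' b b' : a = a' -> b = b' -> Q a b -> Q a' b' by move=> -> ->.
  exact (Qeq _ _ _ _ (mul_malgC _ _) (mul_malgC _ _)
    (pair_subspaceZ p@_m subQ (Qmono m))).
have Qadd v1 w1 v2 w2 : Q v1 w1 -> Q v2 w2 -> Q (v1 + v2) (w1 + w2).
  exact: (pair_subspaceD subQ).
exact (@big_ind2 Lambda Lambda Q 0 +%R 0 +%R subQ.1 Qadd _ _ xpredT _ _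
  (fun m _ => Qterm m)).
Qed.

Lemma star_linear_relation (lam gam : Lambda) (Q : Lambda -> Lambda -> Prop) :
  @pair_subspace K 'I_n L Q ->
  (forall i v w, Q v w -> Q (act lam i v) (act gam i w)) ->
  @linear_relation Lambda (star_module lam) (star_module gam) Q.
Proof.
move=> subQ Qact p v v' w w' Qv Qv'.
have Qp := star_action_relation subQ Qact p Qv.
exact: (pair_subspaceD subQ Qp Qv').
Qed.

Lemma ideal_act_mul (p q : Lambda) : const_term p != 0 -> const_term q != 0 ->
  @act_stable K 'I_n L (p * q) (@ideal K 'I_n L q).
Proof.
by move=> p0 q0 i _ [t ->]; exists (act p i t); exact: (@act_mul K 'I_n L p q i t p0 q0).
Qed.

Lemma act_stable_scale (lam : Lambda) (W : Lambda -> Prop) :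
  @subspace K 'I_n L W -> @act_stable K 'I_n L lam W ->
  forall (p : Lambda) (x y : star_module lam), W x -> W y -> W (p *: x + y).
Proof.
move=> subW stW p x y Wx Wy.
(* A relation that ignores its second entry reduces stability of [W] to the statement on pairs. *)
have subQ : @pair_subspace K 'I_n L (fun v _ => W v).
  by split=> [|k v w v' w' Wv Wv']; [exact: subW.1|exact: subW.2].
exact: (star_linear_relation subQ (fun i v w => stW i v) p (x' := y) (y' := y) Wx Wy).
Qed.

Lemma scale_act_stable (lam : Lambda) (W : Lambda -> Prop) : W 0 ->
  (forall (p : Lambda) (x y : star_module lam), W x -> W y -> W (p *: x + y)) ->
  @subspace K 'I_n L W /\ @act_stable K 'I_n L lam W.
Proof.
move=> W0 Wlin; split.
  split=> // k a b Wa Wb; have := Wlin k%:MP a b Wa Wb.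
  have := star_module_constE k (a : star_module lam).
  by move=> ->; rewrite scalarE.
move=> i a Wa; have := Wlin (freealg_var K i) a 0 Wa W0.
by rewrite addr0 star_module_varE star_act.
Qed.

Lemma irreducible_simple (lam : Lambda) : const_term lam != 0 ->
  irreducible lam <-> simple_module (cofactor_module lam).
Proof.
move=> lam0; split=> [irr|simple_lam].
  apply/simple_submoduleP; split.
    exists (1 : Lambda); last exact: oner_neq0.
    have [[l0 lnu] _] := irr; apply/cofactor_spanE.
    exact: (@cofactors_non_unit K 'I_n L lam l0 lnu).
  move=> P P0 Plin PV; have [subP stP] := scale_act_stable P0 Plin.
  have PV' w : P w -> cofactors lam w by move=> /PV/cofactor_spanE.
  have [Pz|VP] :=
    @irreducible_no_act_stable K 'I_n L lam P lam0 irr subP stP PV'; first by left.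
  by right=> v /cofactor_spanE/VP.
have [[v vV v0] simple_V] := (simple_submoduleP _).1 simple_lam.
apply: (@no_act_stable_irreducible K 'I_n L lam lam0).
  by exists v; [exact/cofactor_spanE|exact/eqP].
move=> W subW stW WV.
have [Wz|VW] := simple_V W subW.1 (act_stable_scale subW stW)
  (fun w Ww => (cofactor_spanE lam w).2 (WV w Ww)); first by left.
by right=> w /cofactor_spanE/VW.
Qed.

Lemma const_termM (p q : Lambda) : const_term (p * q) = const_term p * const_term q.
Proof. exact: (rmorphM const_term_morphism). Qed.

(** The term [S j] is the part of [V_lam] in the left ideal of the suffix product [rho j]. It is 0
    for [rho 0 = lam] by [cofactors_ideal] and everything for [rho m = 1]; [factor_relation]
    identifies the factors. *)
Lemma irreducible_series (lam : Lambda) (m : nat) (pi : 'I_m -> Lambda) :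
  const_term lam != 0 -> (forall i, irreducible (pi i)) -> lam = \prod_i pi i ->
  exists2 S, composition_series m S &
    forall i : 'I_m, mod_iso (@composition_factor _ (cofactor_module lam) S i)
                             (cofactor_module (pi i)).
Proof.
move=> lam0 pi_irr; have [al [rho [rho0 rhom rhoS split_lam]]] := prod_suffix pi.
move=> def_lam; rewrite -def_lam in rho0 split_lam.
have nz j : const_term (al j) != 0 /\ const_term (rho j) != 0.
  apply/andP; rewrite -negb_or -mulf_eq0 -const_termM -split_lam; exact: lam0.
have pi0 i : const_term (pi i) != 0.
  have := (nz i).2; rewrite (rhoS i) const_termM mulf_eq0 negb_or.
  by case/andP.
have exS j : exists S : submodClosed (cofactor_module lam),
    forall x, x \in S <-> @ideal K 'I_n L (rho j) (submodule_val x).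
  have subI := @ideal_subspace K 'I_n L (rho j).
  apply: submodule_of_prop; first exact: subI.1.
  move=> a x y; apply: (act_stable_scale subI).
  by rewrite (split_lam j); exact: ideal_act_mul (nz j).1 (nz j).2.
have [S SP] := choice exS.
have iso (i : 'I_m) : mod_iso (@composition_factor _ (cofactor_module lam) S i)
                             (cofactor_module (pi i)).
  have lam_i : lam = al i * pi i * rho i.+1 by rewrite -mulrA -rhoS; exact: split_lam.
  pose Q := @factor_relation K 'I_n L (pi i) (rho i.+1).
  have linQ := @star_linear_relation lam (pi i) Q
    (@factor_relation_subspace K 'I_n L (pi i) (rho i.+1))
    (@factor_relation_act K 'I_n L lam _ _ _ lam0 lam_i).
  apply: (@subquotient_submodule_iso _ (cofactor_module lam) (star_module (pi i))
    (S i.+1) (S i) _ (fun x w => Q (submodule_val x) w)).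
  - by move=> p x x' y y'; exact: linQ.
  - move=> x /SP xI; have /cofactor_spanE xV := valP x.
    have [w wV xw] := @factor_relation_left K 'I_n L lam _ _ _ lam0 lam_i _ xV xI.
    by exists w => //; exact/cofactor_spanE.
  - move=> w /cofactor_spanE wV.
    have [v [vV vI] vw] := @factor_relation_right K 'I_n L lam _ _ _ lam0 lam_i _ wV.
    have vV' := (cofactor_spanE lam v).2 vV.
    by exists (Submodule vV') => //; exact/SP.
  move=> x w _ /cofactor_spanE wV xw; rewrite SP (rhoS i).
  exact: (@factor_relation_eq0 K 'I_n L lam _ _ _ lam0 lam_i _ _ wV xw).
exists S => //; split.
- move=> x; rewrite inE; apply/idP/eqP=> [/SP|->]; last exact: rpred0.
  rewrite rho0 => xI; apply: val_inj; have /cofactor_spanE xV := valP x.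
  exact: (@cofactors_ideal K 'I_n L lam _ xV xI).
- move=> x; rewrite [RHS]inE; apply/SP; rewrite rhom.
  by exists (submodule_val x); rewrite mulr1.
move=> i im; split=> [x /SP xI|].
  apply/SP; case: xI => t ->; rewrite (rhoS (Ordinal im)) /=.
  by exists (t * pi (Ordinal im)); exact: mulrA.
have simple_pi := (irreducible_simple (pi0 (Ordinal im))).1 (pi_irr _).
exact: simple_mod_iso (mod_iso_sym (iso (Ordinal im))) simple_pi.
Qed.

Lemma degree_gt0_non_constant (p : Lambda) :
  (0 < freealg_degree p)%N -> p <> (const_term p)%:MP.
Proof.
move=> + def_p; rewrite /freealg_degree def_p mmeasureC.
by case: (_ != 0).
Qed.

Lemma cofactor_module_iso_pair (lam gam : Lambda) :
  const_term lam != 0 -> const_term gam != 0 ->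
  (0 < freealg_degree lam)%N -> (0 < freealg_degree gam)%N ->
  mod_iso (cofactor_module lam) (cofactor_module gam) <->
  exists a b, @similarity_pair K 'I_n L lam gam a b.
Proof.
move=> l0 g0 /degree_gt0_non_constant l_nc /degree_gt0_non_constant g_nc.
split=> [[f [h fK hK]]|[a [b ab]]].
  (* The graph of [f], seen in the ambient algebra; the similarity pair consists of the image and
     the preimage of 1. *)
  pose Q (v w : Lambda) := exists x : cofactor_module lam,
    v = submodule_val x /\ w = submodule_val (f x).
  have lV := (cofactor_spanE lam 1).2 (@cofactors1 K 'I_n L lam l_nc).
  have gV := (cofactor_spanE gam 1).2 (@cofactors1 K 'I_n L gam g_nc).
  pose xl : cofactor_module lam := Submodule lV.
  pose xg : cofactor_module gam := Submodule gV.
  exists (submodule_val (f xl)), (submodule_val (h xg)).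
  have Q1 : Q 1 (submodule_val (f xl)).
    exact (ex_intro _ xl (conj (erefl _) (erefl _))).
  have Q1' : Q (submodule_val (h xg)) 1.
    exact (ex_intro _ (h xg) (conj (erefl _) (congr1 _ (esym (hK xg))))).
  apply: (fun relQ => @act_relation_pair K 'I_n L lam gam Q _ _ l0 g0 relQ Q1 Q1').
  split.
  - move=> _ _ [x [-> ->]].
    by split; [apply/(cofactor_spanE lam)|apply/(cofactor_spanE gam)]; exact: valP.
  - move=> k _ _ _ _ [x [-> ->]] [y [-> ->]].
    exists (k%:MP *: x + y); split.
      have e := star_module_constE k (submodule_val x).
      exact: (congr1 (fun z => z + submodule_val y) (esym (etrans e (scalarE _ _)))).
    rewrite linearP.
    have e := star_module_constE k (submodule_val (f x)).
    exact: (congr1 (fun z => z + submodule_val (f y)) (esym (etrans e (scalarE _ _)))).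
  - move=> _ _ [x [-> ->]]; split=> x0.
      have -> : x = 0 by exact: val_inj.
      by rewrite linear0.
    have fx0 : f x = 0 by exact: val_inj.
    have x0' : x = 0 := can_inj fK (etrans fx0 (esym (linear0 f))).
    exact: (congr1 (@submodule_val _ _ _) x0').
  move=> i _ _ [x [-> ->]]; exists (freealg_var K i *: x); split.
    exact: esym (etrans (star_module_varE i (submodule_val x)) (star_act _ _ _)).
  rewrite linearZ.
  exact: esym (etrans (star_module_varE i (submodule_val (f x))) (star_act _ _ _)).
have ba := @similarity_pair_sym K 'I_n L _ _ _ _ ab.
pose Q := @mul_relation K 'I_n L gam a.
apply: (@submodule_iso _ (star_module lam) (star_module gam) _ _ Q).
- exact: (star_linear_relation (@mul_relation_subspace K 'I_n L gam a)
    (@mul_relation_act K 'I_n L lam gam a b l0 g0 ab)).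
- move=> u /cofactor_spanE lu.
  have [w gw uw] := @mul_relation_total K 'I_n L lam gam a b l0 g0 ab u lu.
  by exists w => //; exact/cofactor_spanE.
- move=> w /cofactor_spanE gw.
  have [u lu wu] := @mul_relation_total K 'I_n L gam lam b a g0 l0 ba w gw.
  exists u; first exact/cofactor_spanE.
  exact: (@mul_relation_sym K 'I_n L lam gam a b ab).
move=> u w /cofactor_spanE lu /cofactor_spanE gw uw.
exact: (@mul_relation_eq0 K 'I_n L lam gam a b ab u w lu gw uw).
Qed.

Lemma cofactor_module_iso_similar (lam gam : Lambda) :
  const_term lam != 0 -> const_term gam != 0 ->
  (0 < freealg_degree lam)%N -> (0 < freealg_degree gam)%N ->
  mod_iso (cofactor_module lam) (cofactor_module gam) <-> similar_elements gam lam.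
Proof.
move=> l0 g0 l1 g1; apply: (iff_trans (cofactor_module_iso_pair l0 g0 l1 g1)).
exact: iff_sym (@cyclic_iso_pair K 'I_n L lam gam).
Qed.

End FreeAlgebraCofactors.

Theorem theorem2p3 (K : fieldType) (n : nat) (n_gt0 : (0 < n)%N)
    (gam lam : {freealg K[n]})
    (gam_comonic : comonic gam) (gam_deg : (0 < freealg_degree gam)%N)
    (lam_comonic : comonic lam) (lam_deg : (0 < freealg_degree lam)%N) :
  [/\ (* (1) *)
      irreducible lam <-> simple_module (cofactor_module lam),
      (* (2) *)
      (forall (m : nat) (pi : 'I_m -> {freealg K[n]}),
        (forall i, irreducible (pi i)) -> lam = \prod_(i < m) pi i ->
        [/\ has_length (cofactor_module lam) m,
            composition_factors_are (cofactor_module lam)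
              (fun i => cofactor_module (pi i)) &
            forall i, simple_module (cofactor_module (pi i))]),
      (forall (m m' : nat) (pi : 'I_m -> {freealg K[n]})
          (pi' : 'I_m' -> {freealg K[n]}),
        (forall i, irreducible (pi i)) -> lam = \prod_(i < m) pi i ->
        (forall i, irreducible (pi' i)) -> lam = \prod_(i < m') pi' i ->
        m = m'),
      (* (3) *)
      mod_iso (cofactor_module lam) (cofactor_module gam) <->
        mod_iso (cyclic_module gam) (cyclic_module lam) &
      mod_iso (cofactor_module lam) (cofactor_module gam) <->
        similar_elements gam lam].
Proof.
have lam0 : const_term lam != 0 by rewrite lam_comonic oner_neq0.
have gam0 : const_term gam != 0 by rewrite gam_comonic oner_neq0.
have iso_similar := cofactor_module_iso_similar lam0 gam0 lam_deg gam_deg.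
split=> //; first exact: irreducible_simple.
- move=> m pi pi_irr def_lam.
  have [S serS isoS] := irreducible_series lam0 pi_irr def_lam.
  split; first exact: composition_series_length serS.
    exact: composition_series_factors serS _.
  move=> i; apply: simple_mod_iso (isoS i) _.
  by have [_ _ /(_ i (ltn_ord i))[]] := serS.
move=> m m' pi pi' pi_irr def_lam pi'_irr def_lam'.
have [S serS _] := irreducible_series lam0 pi_irr def_lam.
have [S' serS' _] := irreducible_series lam0 pi'_irr def_lam'.
exact: jordan_hoelder serS serS'.
Qed.
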